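(* Let $d\ge1$, let $\psi\in\mathcal P(\mathbb R^d)$ be real-valued and satisfy the Genericity Condition, and let $\gamma>0$. Then any real-valued $f\in\mathcal P_\gamma'(\mathbb R^d)\cap L^1(\mathbb R^d)$ is uniquely determined, up to a constant multiple, by the zero sets of its continuous wavelet transform, i.e. by the zero sets of $f*\psi_\sigma$ for all $\sigma>0$; and more generally it is uniquely determined, up to a constant multiple, by the zero sets of its dyadic wavelet transform, i.e. by the zero sets of $f*\psi_\sigma$ for $\sigma=2^i$, $i\in\mathbb N$. (Here ''uniquely determined up to a constant multiple'' means: if $f,g\in\mathcal P_\gamma'\cap L^1(\mathbb R^d)$ are real-valued and $f*\psi_\sigma$ and $g*\psi_\sigma$ have the same zero set in $\mathbb R^d$ for each $\sigma$ under consideration, then $g=cf$ a.e. for some nonzero constant $c$.)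
   Context: For a multiindex $\alpha$, $\psi^{(\alpha)}$ denotes the mixed partial derivative of orders given by $\alpha$, and $|\alpha|=\alpha_1+\dots+\alpha_d$. For $\gamma>0$, $\mathcal P_\gamma=\mathcal P_\gamma(\mathbb R^d)$ is the space of smooth functions $\psi$ on $\mathbb R^d$ such that $\lim_{|\mathbf x|\to\infty}e^{-\gamma|\mathbf x|}\psi^{(\alpha)}(\mathbf x)=0$ for every multiindex $\alpha$, with topology generated by the seminorms $\|\psi\|_{\gamma,\alpha}=\sup_{\mathbf x}|e^{-\gamma|\mathbf x|}\psi^{(\alpha)}(\mathbf x)|$. $\mathcal P=\bigcap_{\gamma>0}\mathcal P_\gamma$, with topology generated by all seminorms $\|\cdot\|_{\gamma,\alpha}$. $\mathcal P_\gamma'$ is the topological dual of $\mathcal P_\gamma$. An element of $\mathcal P_\gamma'\cap L^1(\mathbb R^d)$ is an integrable function $f$ whose associated distribution $\phi\mapsto\int f\phi$ (on compactly supported smooth $\phi$) extends to a (necessarily unique) element of $\mathcal P_\gamma'$, again denoted $f$. For $\sigma>0$, $\psi_\sigma(\mathbf x)=\sigma^{-d}\psi(\mathbf x/\sigma)$, and $f*\psi_\sigma(\mathbf x)=\langle f,\psi_\sigma(\mathbf x-\cdot)\rangle$. A regular zero of a real function $u$ on $\mathbb R^d$ is a point in every neighborhood of which $u$ takes both positive and negative values. A derivative of fixed order $n\ge0$ of $\psi$ is $\sum_{|\alpha|=n}C_\alpha\psi^{(\alpha)}$ with real constants $C_\alpha$ not all zero, i.e. a nonzero homogeneous constant-coefficient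 differential operator of order $n$ applied to $\psi$, considered modulo multiplication by a nonzero constant. Genericity Condition on $\psi$: for any $n,m\ge0$, the regular zero set of any derivative of $\psi$ of fixed order $n$ is not contained in the zero set of any other derivative of $\psi$ of fixed order $m$. Here two fixed-order derivatives are ''other'' (distinct) if their orders differ, or if their orders agree and their coefficient vectors $(C_\alpha)$ are not proportional. *)

(* Defs.v *)
From HB Require Import structures.
From mathcomp Require Import all_boot all_order all_algebra.
From mathcomp Require Import all_classical all_reals all_analysis.

Set Implicit Arguments.
Unset Strict Implicit.
Unset Printing Implicit Defensive.

Import Order.TTheory GRing.Theory Num.Theory.
Import numFieldNormedType.Exports.

Local Open Scope classical_set_scope.
Local Open Scope ring_scope.

(* The library has Lebesgue measure on R only.  Here 'rV[R]_n is given the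
   sigma-algebra generated by the coordinates (that is, the Borel sets), and
   Lebesgue measure on it is the n-fold product of the one on R. *)

Definition rV_display : measure_display. Proof. exact: default_measure_display. Qed.

Section measurable_rV.
Context (R : realType) (n : nat).

Let coords : 'I_n -> 'rV[R]_n -> measurableTypeR R := fun i x => x ord0 i.

Let rV_set0 : g_sigma_preimage coords set0.
Proof. exact: sigma_algebra0. Qed.

Let rV_setC A : g_sigma_preimage coords A -> g_sigma_preimage coords (~` A).
Proof. exact: sigma_algebraC. Qed.

Let rV_bigcup (F : (set 'rV[R]_n)^nat) :
  (forall i, g_sigma_preimage coords (F i)) ->
  g_sigma_preimage coords (\bigcup_i (F i)).
Proof. exact: sigma_algebra_bigcup. Qed.

HB.instance Definition _ := @isMeasurable.Build rV_display
  'rV[R]_n (g_sigma_preimage coords) rV_set0 rV_setC rV_bigcup.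

Lemma measurable_coord (i : 'I_n) :
  measurable_fun [set: 'rV[R]_n] (fun x => x ord0 i : measurableTypeR R).
Proof.
move=> _ Y mY; rewrite setTI; apply: sub_sigma_algebra => /=.
rewrite -bigcup_seq/=; exists i => /=; first by rewrite mem_index_enum.
by exists Y => //; rewrite setTI.
Qed.

End measurable_rV.

Lemma measurable_fun_rV (R : realType) d (T : measurableType d) n
    (f : T -> 'rV[R]_n) :
  (forall i, measurable_fun [set: T] (fun t => f t ord0 i : measurableTypeR R)) ->
  measurable_fun [set: T] f.
Proof.
move=> mf; apply: (@measurability _ _ _ _ setT f (\big[setU/set0]_(i < n)
  preimage_set_system setT (fun x : 'rV[R]_n => x ord0 i : measurableTypeR R)
    measurable)) => //.
move=> _ [A + <-]; rewrite -bigcup_seq/= => -[i _ [B mB <-]].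
by rewrite setTI; exact: mf.
Qed.

Section lebesgue_rV.
Context (R : realType).

Definition rV_cons n (p : measurableTypeR R * 'rV[R]_n) : 'rV[R]_n.+1 :=
  row_mx (p.1 : R)%:M p.2.

Lemma rV_cons0 n p : @rV_cons n p ord0 ord0 = p.1.
Proof.
rewrite /rV_cons (_ : ord0 = lshift n (ord0 : 'I_1)); last exact/val_inj.
by rewrite (@row_mxEl R 1 1 n) mxE eqxx.
Qed.

Lemma rV_consS n p (i : 'I_n) : rV_cons p ord0 (lift ord0 i) = p.2 ord0 i.
Proof.
rewrite /rV_cons (_ : lift ord0 i = rshift 1 i); last exact/val_inj.
by rewrite (@row_mxEr R 1 1 n).
Qed.

Lemma measurable_rV_cons n : measurable_fun setT (@rV_cons n).
Proof.
apply: measurable_fun_rV => i; have [j ->|->] := unliftP ord0 i.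
- under eq_fun do rewrite rV_consS.
  exact: (measurableT_comp (measurable_coord j) measurable_snd).
- under eq_fun do rewrite rV_cons0.
  exact: measurable_fst.
Qed.

Section step.
Context (n : nat) (mu : {sigma_finite_measure set 'rV[R]_n -> \bar R}).

Definition lebesgue_rV_step : set 'rV[R]_n.+1 -> \bar R :=
  pushforward (@lebesgue_measure R \x mu)%E (@rV_cons n).

Let step_measure := measure_function_pushforward__canonical__measure_function_Measure
  (@lebesgue_measure R \x mu)%E (@measurable_rV_cons n).

HB.instance Definition _ := Measure.copy lebesgue_rV_step step_measure.

Lemma lebesgue_rV_stepE (A : set R) (B : set 'rV[R]_n) :
  measurable (A : set (measurableTypeR R)) -> measurable B ->
  lebesgue_rV_step [set x : 'rV[R]_n.+1 | A (x ord0 ord0) /\ B (\row_i x ord0 (lift ord0 i))]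
  = (lebesgue_measure A * mu B)%E.
Proof.
move=> mA mB; rewrite /lebesgue_rV_step /pushforward -product_measure1E//.
congr product_measure1; apply/seteqP; split=> -[x y] /=;
  rewrite rV_cons0 (_ : \row_i _ = y) //;
  by apply/rowP => i; rewrite mxE rV_consS.
Qed.

Let step_sigma_finite : sigma_finite setT lebesgue_rV_step.
Proof.
have /sigma_finiteP[F [TF ndF Foo]] := sigma_finiteT (@lebesgue_measure R).
have /sigma_finiteP[G [TG ndG Goo]] := sigma_finiteT mu.
pose tl (x : 'rV[R]_n.+1) : 'rV[R]_n := \row_i x ord0 (lift ord0 i).
have mtl : measurable_fun setT tl.
  apply: measurable_fun_rV => i; under eq_fun do rewrite mxE.
  exact: measurable_coord.
exists (fun k => [set x : 'rV[R]_n.+1 | F k (x ord0 ord0) /\ G k (tl x)]) => [|k].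
  apply/esym; rewrite -subTset => x _.
  have [i _ Fi] : (\bigcup_i F i) (x ord0 ord0) by rewrite -TF.
  have [j _ Gj] : (\bigcup_i G i) (tl x) by rewrite -TG.
  exists (maxn i j) => //; split.
    by apply: (subsetPset _ _ (ndF _ _ (leq_maxl i j))).
  by apply: (subsetPset _ _ (ndG _ _ (leq_maxr i j))).
have [mF Fk] := Foo k; have [mG Gk] := Goo k; split.
  apply: measurableI.
    by rewrite -[X in measurable X]setTI; exact: measurable_coord.
  by rewrite -[X in measurable X]setTI; exact: mtl.
by rewrite lebesgue_rV_stepE// lte_mul_pinfty// ge0_fin_numE.
Qed.

HB.instance Definition _ :=
  Measure_isSigmaFinite.Build _ _ _ lebesgue_rV_step step_sigma_finite.

End step.

Fixpoint lebesgue_rV n : {sigma_finite_measure set 'rV[R]_n -> \bar R} :=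
  match n with
  | 0 => \d_(0 : 'rV[R]_0)
  | m.+1 => lebesgue_rV_step (lebesgue_rV m)
  end.

Lemma lebesgue_rV_prod n (A : 'I_n -> set R) :
  (forall i, measurable (A i : set (measurableTypeR R))) ->
  lebesgue_rV n [set x : 'rV[R]_n | forall i, A i (x ord0 i)] =
  (\prod_(i < n) lebesgue_measure (A i))%E.
Proof.
elim: n A => [A _|n IHn A mA].
  by rewrite big_ord0 /= diracE mem_set//= => -[].
have mB : measurable [set x : 'rV[R]_n | forall i, A (lift ord0 i) (x ord0 i)].
  rewrite (_ : [set _ | _] = \bigcap_(i in [set: 'I_n])
    ((fun x : 'rV[R]_n => x ord0 i : measurableTypeR R) @^-1` A (lift ord0 i))).
    apply: fin_bigcap_measurable => // i _.
    by rewrite -[X in measurable X]setTI; exact: measurable_coord.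
  by apply/seteqP; split=> x /= h i => [_|]; exact: h.
rewrite big_ord_recl -IHn// -lebesgue_rV_stepE//=; congr lebesgue_rV_step.
apply/seteqP; split=> x /= => [h|[h0 hS] i].
  by split=> // i; rewrite mxE.
by have [j ->|->//] := unliftP ord0 i; have := hS j; rewrite mxE.
Qed.

End lebesgue_rV.

Section wavelet.
Context (R : realType) (d : nat).
Local Notation Rd := 'rV[R]_d.
Implicit Types (x y : Rd) (u phi psi f g : Rd -> R) (gamma sigma : R).
Implicit Types (T : (Rd -> R) -> R).

(* The norm `|x| on 'rV[R]_d is the maximum norm. *)
Definition enorm x : R := Num.sqrt (\sum_(i < d) x ord0 i ^+ 2).

Definition at_infty : set_system Rd :=
  [set A | \forall M \near +oo, forall x, M < enorm x -> A x].

Global Instance at_infty_filter : Filter at_infty.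
Proof.
split.
- exact: nearW.
- by move=> A B FA FB; apply: (@filterS2 _ +oo_R) FA FB => M MA MB x Mx; split; auto.
- by move=> A B AB; apply: (@filterS _ +oo_R) => M MA x /MA /AB.
Qed.

Definition multiindex := {ffun 'I_d -> nat}.
Implicit Types a : multiindex.

Definition mdegree a : nat := (\sum_(i < d) a i)%N.

Definition partial (i : 'I_d) u : Rd -> R := fun x => 'D_(delta_mx ord0 i) u x.

Definition mpartial a u : Rd -> R :=
  foldr (fun i v => iter (a i) (partial i) v) u (enum 'I_d).

(* All iterated partial derivatives, in any order, exist and are continuous. *)
Definition smooth u : Prop := forall s : seq 'I_d,
  let v := foldr partial u s in
  continuous v /\ forall i x, derivable v x (delta_mx ord0 i).

Definition expw gamma phi a x : R := expR (- gamma * enorm x) * mpartial a phi x.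

Definition Pspace gamma : set (Rd -> R) :=
  [set phi | smooth phi /\ forall a, expw gamma phi a @ at_infty --> 0].

Definition Pseminorm gamma a phi : R :=
  sup (range (fun x => `|expw gamma phi a x|)).

(* The trace on Pspace gamma of the neighborhoods of phi0, for the topology
   generated by the seminorms. *)
Definition Pnbhs gamma phi0 : set_system (Rd -> R) :=
  [set U | exists (A : seq multiindex) (e : R), 0 < e /\
    [set phi | Pspace gamma phi /\
      forall a, a \in A -> Pseminorm gamma a (phi - phi0) < e] `<=` U].

Definition Pall : set (Rd -> R) :=
  \bigcap_(gamma in [set gamma | 0 < gamma]) Pspace gamma.

(* Functionals are total; only their values on Pspace gamma matter. *)
Definition Pdual gamma : set ((Rd -> R) -> R) := [set T |
  (forall (k : R) phi psi, Pspace gamma phi -> Pspace gamma psi ->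
     T (k *: phi + psi) = k * T phi + T psi) /\
  (forall phi, Pspace gamma phi -> T @ Pnbhs gamma phi --> T phi)].

Definition test_function phi : Prop :=
  smooth phi /\ compact (closure [set x | phi x != 0]).

(* f is integrable, and T is the element of the dual that extends its
   distribution (T is determined by f on Pspace gamma). *)
Definition PdualL1 gamma f T : Prop :=
  [/\ (lebesgue_rV R d).-integrable setT (EFin \o f),
      Pdual gamma T &
      forall phi, test_function phi ->
        T phi = \int[lebesgue_rV R d]_x (f x * phi x)].

Definition dilate sigma psi x : R := sigma ^- d * psi (sigma^-1 *: x).

Definition conv T psi x : R := T (fun y => psi (x - y)).

Definition zeros u : set Rd := [set x | u x = 0].

Definition regular_zeros u : set Rd := [set x | forall V, nbhs x V ->
  (exists2 y, V y & 0 < u y) /\ (exists2 y, V y & u y < 0)].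

(* Only the coefficients C a with mdegree a = n matter in an operator of
   order n. *)
Definition hdiff n (C : multiindex -> R) psi x : R :=
  \sum_(a \in [set a | mdegree a = n]) C a * mpartial a psi x.

Definition nonzero_coeffs n (C : multiindex -> R) : Prop :=
  exists2 a, mdegree a = n & C a != 0.

Definition proportional n (C C' : multiindex -> R) : Prop :=
  exists2 c : R, c != 0 & forall a, mdegree a = n -> C' a = c * C a.

Definition generic psi : Prop := forall n m (C C' : multiindex -> R),
  nonzero_coeffs n C -> nonzero_coeffs m C' ->
  ~ (n = m /\ proportional n C C') ->
  ~ (regular_zeros (hdiff n C psi) `<=` zeros (hdiff m C' psi)).

Definition determined_by_zeros gamma psi (S : set R) : Prop :=
  forall f g Tf Tg, PdualL1 gamma f Tf -> PdualL1 gamma g Tg ->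
  (forall sigma, S sigma ->
     zeros (conv Tf (dilate sigma psi)) = zeros (conv Tg (dilate sigma psi))) ->
  exists2 c : R, c != 0 & {ae lebesgue_rV R d, forall x, g x = c * f x}.

End wavelet.

(* Main.v *)
(* With t = 1 / sigma, the rescaled transform z |-> T (fun y => psi (z - t y)) has,
   as t tends to 0, a Taylor expansion whose coefficient of order n is, up to a
   constant, the derivative of psi of order n with coefficients the moments of f of
   order n. By the intermediate value theorem, every regular zero of the first
   nonzero coefficient of f is a limit of zeros of the transform of f, hence of g,
   so it is a zero of the first nonzero coefficient of g. Genericity then forces
   these two coefficients to have the same order and to be proportional, by a
   factor c. If g - c f had a nonzero moment, the same argument applied to f and
   g - c f would contradict genericity, since the order of its first nonzero
   coefficient is strictly larger.

   It remains to see that h in L^1 with all moments zero vanishes. Low-frequency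
   sines and cosines are sums of their Taylor series in P_gamma, so multiplying by
   them preserves the space of functions phi such that h kills all x^alpha phi.
   Hence h kills all polynomials in the sin (t (x_i - c_i)), t small; bounded
   pointwise limits of these, as t tends to 0, include the indicators of orthants. *)
Require Import Defs.
From mathcomp Require Import all_boot all_order all_algebra.
From mathcomp Require Import all_classical all_reals all_analysis.
From mathcomp Require Import measurable_realfun.
From mathcomp Require Import ring lra.

Set Implicit Arguments.
Unset Strict Implicit.
Unset Printing Implicit Defensive.

Import Order.TTheory GRing.Theory Num.Theory.
Import numFieldNormedType.Exports.

Local Open Scope classical_set_scope.
Local Open Scope ring_scope.

(** * Directional and partial derivatives *)

(** The moments of [f] are the numbers [T (mono w)], not integrals: x^alpha f need not be
    integrable, and [T] is tied to [f] only on test functions. Cutoffs extend the integral formula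
    to tame functions that are bounded and measurable, which is why uniqueness is tested on sines
    and not on polynomials. The analysis takes place on tame functions, whose derivatives of every
    order are O(exp (e |y|)) for each e > 0. They form an algebra that contains psi, polynomials,
    sines and cutoffs and is stable under affine substitutions; on it [T] obeys one estimate with
    finitely many derivatives and one exponent e. This exponent is repeatedly split in halves, one
    for the function, the other for a polynomial weight or a second factor. Comparing first nonzero
    coefficients leaves out the case where only one of [f], [g] has a nonzero moment. The other
    function is then 0 almost everywhere, and genericity has to exclude an identically vanishing
    transform. *)

Section lines.
Context (R : realType) (V : normedModType R).
Implicit Types (u : V -> R) (x v : V).

(** The quotient involves [u] only through [u (x + h *: v)], so in this form changes of line, scale
    and origin reduce to rewriting an argument. *)
Lemma is_derive_epsP u x v l :
  is_derive x v u l <-> (forall e : R, 0 < e -> exists2 r : R, 0 < r &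
    forall h : R, h != 0 -> `|h| < r -> `|l - h^-1 * (u (x + h *: v) - u x)| < e).
Proof.
have E (h : R) : h^-1 *: ((u \o shift x) (h *: v) - u x) =
    h^-1 * (u (x + h *: v) - u x) by rewrite /= [h *: v + x]addrC.
split=> [[/cvg_ex[/= l' cl'] dl] e e0|H].
  have {}dl : l' = l by rewrite -dl; apply/esym/cvg_lim.
  move: cl'; rewrite dl => /cvgr_dist_lt /(_ _ e0).
  rewrite /dnbhs near_withinE => /nbhs_ballP[r /= r0 rP].
  exists r => // h h0 hr; have := rP h; rewrite E; apply => //.
  by rewrite -ball_normE/= sub0r normrN.
have cl : h^-1 *: ((u \o shift x) (h *: v) - u x) @[h --> 0^'] --> l.
  apply/cvgrPdist_lt => e /H[r r0 rP].
  rewrite /dnbhs near_withinE; apply/nbhs_ballP; exists r => // h.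
  by rewrite -ball_normE/= sub0r normrN => hr h0; rewrite E; exact: rP.
by split; [apply/cvg_ex; exists l|apply/cvg_lim].
Qed.

End lines.

Section lines2.
Context (R : realType) (V : normedModType R).
Implicit Types (u : V -> R) (x v : V).

Lemma is_derive_line u x v s l :
  is_derive (x + s *: v) v u l <-> is_derive s (1 : R) (fun r => u (x + r *: v)) l.
Proof.
rewrite (is_derive_epsP u) (@is_derive_epsP R R (fun r : R => u (x + r *: v))).
have E (h : R) : x + s *: v + h *: v = x + (s + h%:A) *: v by rewrite [h%:A]mulr1 scalerDl addrA.
split=> H e e0; have [r r0 rP] := H e e0; exists r => // h h0 hr;
  by have := rP h h0 hr; rewrite E; apply.
Qed.

Lemma is_derive_scale u x v (c l : R) :
  is_derive x v u l -> is_derive x (c *: v) u (c * l).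
Proof.
have [-> _|c0 H] := eqVneq c 0.
  by rewrite scale0r mul0r; apply: is_derive0.
apply/is_derive_epsP => e e0.
have [r r0 rP] := (is_derive_epsP u x v l).1 H (e / `|c|) ltac:(by rewrite divr_gt0// normr_gt0).
exists (r / `|c|); first by rewrite divr_gt0// normr_gt0.
move=> h h0 hr; have := rP (h * c); rewrite mulf_neq0// normrM -ltr_pdivlMr ?normr_gt0//.
move=> /(_ isT hr); rewrite ltr_pdivlMr ?normr_gt0// -normrM scalerA.
rewrite (_ : (l - _) * c = c * l - h^-1 * (u (x + (h * c) *: v) - u x)) ?(mulrC _ e)//.
by rewrite mulrBl invfM; field; rewrite h0 c0.
Qed.

Lemma mvt (g dg : R -> R) (a b : R) : (forall x : R, is_derive x 1 g (dg x)) ->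
  exists2 c, `|c - a| <= `|b - a| & g b - g a = dg c * (b - a).
Proof.
move=> dgE; have cg : continuous g.
  move=> x; apply: differentiable_continuous; apply/derivable1_diffP.
  by have [] := dgE x.
have [ab|ba] := leP a b.
  have [c cab e] := @MVT_segment _ g dg a b ab (fun t _ => dgE t) (continuous_subspaceT cg).
  exists c => //; move: cab; rewrite in_itv/= => /andP[ac cb].
  by rewrite !ger0_norm ?subr_ge0// lerB.
have [c cab e] := @MVT_segment _ g dg b a (ltW ba) (fun t _ => dgE t) (continuous_subspaceT cg).
exists c; last by rewrite -opprB e -mulrN opprB.
move: cab; rewrite in_itv/= => /andP[bc ca].
by rewrite !ler0_norm ?subr_le0// ?(ltW ba)// !opprB lerB.
Qed.

End lines2.

(** * Total derivative and symmetry of mixed derivatives *)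

Section words.
Context (R : realType) (d : nat).
Local Notation Rd := 'rV[R]_d.
Implicit Types (u v : Rd -> R) (x y z : Rd) (i j : 'I_d) (w : seq 'I_d).

(* Equivalent to [enorm], with a simpler triangle inequality. *)
Definition norm1 x : R := \sum_i `|x ord0 i|.
Local Notation "'e_ i" := (delta_mx ord0 i : Rd) (at level 8, i at level 2).

Lemma norm1_ge0 x : 0 <= norm1 x.
Proof. exact: sumr_ge0. Qed.

Lemma norm1D x y : norm1 (x + y) <= norm1 x + norm1 y.
Proof. by rewrite -big_split ler_sum// => i _; rewrite mxE ler_normD. Qed.

Lemma norm1Z (c : R) x : norm1 (c *: x) = `|c| * norm1 x.
Proof. by rewrite mulr_sumr; apply: eq_bigr => i _; rewrite mxE normrM. Qed.

Lemma norm1N x : norm1 (- x) = norm1 x.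
Proof. by rewrite -scaleN1r norm1Z normrN1 mul1r. Qed.

Lemma coord_norm1 x i : `|x ord0 i| <= norm1 x.
Proof. by rewrite /norm1 (bigD1 i)//= lerDl sumr_ge0. Qed.

Lemma norm_norm1 x : `|x| <= norm1 x.
Proof.
have [->|x0] := eqVneq x 0; first by rewrite normr0 norm1_ge0.
have /mx_norm_neq0[[a i] /=] : mx_norm x != 0 by rewrite -[mx_norm x]/`|x| normr_eq0.
by rewrite -[mx_norm x]/`|x| => ->; rewrite (ord1 a) coord_norm1.
Qed.

Lemma coord_norm x i : `|x ord0 i| <= `|x|.
Proof.
rewrite [leRHS]mx_normrE; apply: le_trans (le_bigmax _ _ (ord0, i)) => //.
Qed.

Lemma norm1_norm x : norm1 x <= d%:R * `|x|.
Proof.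
rewrite /norm1 (le_trans (ler_sum _ (fun i _ => coord_norm x i)))//.
by rewrite sumr_const card_ord mulr_natl.
Qed.

Lemma norm1_delta i : norm1 'e_i = 1.
Proof.
rewrite /norm1 (bigD1 i)//= mxE !eqxx normr1 big1 ?addr0// => j ji.
by rewrite mxE eqxx (negPf ji) normr0.
Qed.

Lemma norm1_delta_le (c : R) i : norm1 (c *: 'e_i) = `|c|.
Proof. by rewrite norm1Z norm1_delta mulr1. Qed.

(** The direction is built one coordinate at a time. The mean value theorem along the new coordinate
    gives a partial derivative at a nearby point, and its continuity at [x] brings it back to
    [x]. *)
Lemma is_derive_partials u x (v : Rd) :
  (forall i y, derivable u y 'e_i) -> (forall i, continuous (partial i u)) ->
  is_derive x v u (\sum_i v ord0 i * partial i u x).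
Proof.
move=> du cu; rewrite {1}[v]row_sum_delta.
elim/big_rec2: _ => [|i l v' _ IH]; first exact: is_derive0.
rewrite addrC [X in is_derive _ _ _ X]addrC.
set c := v ord0 i; apply/is_derive_epsP => e e0.
have e2 : 0 < e / 2 by rewrite divr_gt0.
have [r r0 rP] := (is_derive_epsP u x v' l).1 IH _ e2.
have e3 : 0 < e / 2 / (`|c| + 1) by rewrite divr_gt0// ltr_wpDl.
have /cvgr_dist_lt /(_ _ e3) /nbhs_ballP[r' /= r'0 r'P] := cu i x.
pose q := r' / (norm1 v' + `|c| + 1).
have q0 : 0 < q by rewrite divr_gt0// ltr_wpDl// addr_ge0// norm1_ge0.
exists (Num.min r q); first by rewrite lt_min r0.
move=> h h0; rewrite lt_min => /andP[hr hq].
have [th thP E] := @mvt R (fun t => u (x + h *: v' + t *: 'e_i))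
  (fun t => partial i u (x + h *: v' + t *: 'e_i)) 0 (h * c)
  (fun t => (is_derive_line _ _ _ _ _).1 (derivableP (du i (x + h *: v' + t *: 'e_i)))).
move: thP E; rewrite !subr0 scale0r addr0 => thP E.
set y := x + h *: v' + th *: 'e_i in E.
have yx : `|x - y| < r'.
  rewrite /y -addrA opprD addrA subrr sub0r normrN.
  apply: (le_lt_trans (norm_norm1 _)); apply: (le_lt_trans (norm1D _ _)).
  rewrite norm1_delta_le norm1Z; apply: (@le_lt_trans _ _ (`|h| * (norm1 v' + `|c| + 1))).
    rewrite mulrDr mulrDr mulr1 -addrA lerD2l.
    by rewrite (le_trans thP)// normrM lerDl.
  by rewrite -ltr_pdivlMr// ltr_wpDl// addr_ge0// norm1_ge0.
have := r'P y; rewrite -ball_normE/= => /(_ yx) Hy.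
have -> : u (x + h *: (v' + c *: 'e_i)) - u x =
    (u (x + h *: v') - u x) + partial i u y * (h * c).
  by rewrite -E scalerDr scalerA [x + (_ + _)]addrA; ring.
rewrite mulrDr; have -> : h^-1 * (partial i u y * (h * c)) = c * partial i u y by field.
rewrite opprD addrACA (le_lt_trans (ler_normD _ _))// (splitr e) ltr_leD ?rP//.
rewrite -mulrBr normrM.
apply: (@le_trans _ _ (`|c| * (e / 2 / (`|c| + 1)))); first by rewrite ler_wpM2l ?normr_ge0// ltW.
rewrite mulrA ler_pdivrMr ?ltr_wpDl// mulrC ler_wpM2l ?lerDl//; exact: ltW.
Qed.

(* Both mixed derivatives are limits of the same second difference quotient. *)
Lemma schwarz u i j :
  (forall y, derivable u y 'e_i) -> (forall y, derivable u y 'e_j) ->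
  (forall y, derivable (partial i u) y 'e_j) ->
  (forall y, derivable (partial j u) y 'e_i) ->
  continuous (partial j (partial i u)) -> continuous (partial i (partial j u)) ->
  partial j (partial i u) = partial i (partial j u).
Proof.
have key i' j' x h : (forall y, derivable u y 'e_i') ->
    (forall y, derivable (partial i' u) y 'e_j') -> 0 < h ->
    exists2 p, `|x - p| <= h + h &
      u (x + h *: 'e_i' + h *: 'e_j') - u (x + h *: 'e_i') - u (x + h *: 'e_j') + u x
      = partial j' (partial i' u) p * h * h.
  move=> dui duij h0.
  have dg s : is_derive s (1 : R)
      (fun s => u (x + h *: 'e_j' + s *: 'e_i') - u (x + s *: 'e_i'))
      (partial i' u (x + h *: 'e_j' + s *: 'e_i') - partial i' u (x + s *: 'e_i')).
    by apply: is_deriveB; apply/(is_derive_line u); exact: derivableP.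
  have [s sh E] := @mvt R _ _ 0 h dg.
  have [t th F] := @mvt R (fun t => partial i' u (x + s *: 'e_i' + t *: 'e_j'))
    (fun t => partial j' (partial i' u) (x + s *: 'e_i' + t *: 'e_j')) 0 h
    (fun t => (is_derive_line _ _ _ _ _).1
       (derivableP (duij (x + s *: 'e_i' + t *: 'e_j')))).
  exists (x + s *: 'e_i' + t *: 'e_j').
    rewrite -addrA opprD addrA subrr sub0r normrN (le_trans (norm_norm1 _))//.
    rewrite (le_trans (norm1D _ _))// !norm1_delta_le lerD//.
      by move: sh; rewrite !subr0 [X in _ <= X]gtr0_norm.
    by move: th; rewrite !subr0 [X in _ <= X]gtr0_norm.
  move: E F; rewrite !subr0 !scale0r !addr0 [x + s *: _ + h *: _]addrAC => E F.
  by rewrite -F -E [x + h *: _ + h *: _]addrAC; ring.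
move=> dui duj duij duji cij cji; apply/funext => x.
apply/eqP; rewrite -subr_eq0 -normr_eq0; apply/eqP/le_anti; rewrite normr_ge0 andbT.
apply/ler_addgt0Pr => e e0; rewrite add0r.
have e2 : 0 < e / 2 by rewrite divr_gt0.
have /cvgr_dist_lt /(_ _ e2) /nbhs_ballP[r /= r0 rP] := cij x.
have /cvgr_dist_lt /(_ _ e2) /nbhs_ballP[s /= s0 sP] := cji x.
have [h h0 hh] : exists2 h : R, 0 < h & h + h < Num.min r s.
  have m0 : 0 < Num.min r s by rewrite lt_min r0.
  by exists (Num.min r s / 4); move: (Num.min r s) m0 => m m0; lra.
have [p px Ep] := key i j x h dui duij h0.
have [q qx Eq] := key j i x h duj duji h0.
have hr : h + h < r by rewrite (lt_le_trans hh)// ge_min lexx.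
have hs : h + h < s by rewrite (lt_le_trans hh)// ge_min lexx orbT.
have pq : partial j (partial i u) p = partial i (partial j u) q.
  move: Ep Eq; move: (partial j _ p) (partial i _ q) => a b Ea Eb.
  apply: (mulIf (lt0r_neq0 h0)); apply: (mulIf (lt0r_neq0 h0)).
  rewrite -Ea -Eb [x + h *: _ + h *: _]addrAC; congr (_ + _).
  by rewrite -!addrA; congr (_ + _); rewrite addrC.
have Hp : `|partial j (partial i u) x - partial j (partial i u) p| < e / 2.
  by apply: rP; rewrite -ball_normE/=; exact: le_lt_trans hr.
have Hq : `|partial i (partial j u) x - partial j (partial i u) p| < e / 2.
  by rewrite pq; apply: sP; rewrite -ball_normE/=; exact: le_lt_trans hs.
move: Hp Hq; clear -e0; move: (partial j _ x) (partial j _ p) (partial i _ x) => a b c Ha Hb.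
rewrite (le_trans (ler_distD b _ _))// (splitr e) lerD//; first exact: ltW.
by rewrite distrC ltW.
Qed.

End words.

(** * Smooth functions and derivatives indexed by words *)

Section smooth.
Context (R : realType) (d : nat).
Local Notation Rd := 'rV[R]_d.
Implicit Types (u v : Rd -> R) (x y z : Rd) (i j : 'I_d) (w : seq 'I_d).
Local Notation "'e_ i" := (delta_mx ord0 i : Rd) (at level 8, i at level 2).

(** Words record the order of derivation, which allows induction at either end; [Dw_mult] returns to
    multiindices once partial derivatives commute. *)
Definition Dw w u : Rd -> R := foldr (@partial R d) u w.
Arguments Dw : simpl never.

Lemma Dw_cons i w u : Dw (i :: w) u = partial i (Dw w u). Proof. by []. Qed.

Lemma Dw_rcons w i u : Dw (rcons w i) u = Dw w (partial i u).
Proof. by rewrite /Dw foldr_rcons. Qed.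

Lemma Dw_cat w w' u : Dw (w ++ w') u = Dw w (Dw w' u).
Proof. by rewrite /Dw foldr_cat. Qed.

(* A sealed copy of [smooth], which unification would otherwise unfold at great cost. *)
Variant csmooth u : Prop := CSmooth of smooth u.

Lemma csmooth_smooth u : csmooth u -> smooth u. Proof. by case. Qed.

Lemma smooth_continuous u : csmooth u -> continuous u.
Proof. by case=> /(_ [::])[]. Qed.

Lemma smooth_derivable u : csmooth u -> forall i x, derivable u x 'e_i.
Proof. by case=> /(_ [::])[]. Qed.

Lemma smooth_Dw w u : csmooth u -> csmooth (Dw w u).
Proof. by case=> su; split=> w'; have := su (w' ++ w); rewrite foldr_cat. Qed.

Lemma smooth_partial i u : csmooth u -> csmooth (partial i u).
Proof. exact: (@smooth_Dw [:: i]). Qed.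

Lemma is_derive_partial i u x : csmooth u -> is_derive x 'e_i u (partial i u x).
Proof. by move=> su; apply: derivableP; exact: smooth_derivable. Qed.

(** A coinduction principle: the smoothness proofs below exhibit a class of continuous, partially
    derivable functions that derivation does not leave. *)
Lemma smooth_class (C : set (Rd -> R)) :
  (forall u, C u -> [/\ continuous u, forall i x, derivable u x 'e_i
                      & forall i, C (partial i u)]) ->
  forall u, C u -> csmooth u.
Proof.
move=> CP u Cu; split=> w; suff Cw : C (foldr (@partial R d) u w) by case: (CP _ Cw).
by elim: w => //= i w /CP[].
Qed.

Lemma is_derive_smooth u x (v : Rd) : csmooth u ->
  is_derive x v u (\sum_i v ord0 i * partial i u x).
Proof.
move=> su; apply: is_derive_partials => [i y|i]; first exact: smooth_derivable.
exact/smooth_continuous/smooth_partial.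
Qed.

Lemma is_derive_smooth_line u x (v : Rd) (s : R) : csmooth u ->
  is_derive s 1 (fun s => u (x + s *: v)) (\sum_i v ord0 i * partial i u (x + s *: v)).
Proof. by move=> su; apply/(is_derive_line u); exact: is_derive_smooth. Qed.

Lemma partialC u i j : csmooth u -> partial i (partial j u) = partial j (partial i u).
Proof.
move=> su; apply: schwarz; [exact: smooth_derivable| exact: smooth_derivable | | | |].
- exact/smooth_derivable/smooth_partial.
- exact/smooth_derivable/smooth_partial.
- exact/smooth_continuous/smooth_partial/smooth_partial.
- exact/smooth_continuous/smooth_partial/smooth_partial.
Qed.

Lemma partialD u v i : csmooth u -> csmooth v ->
  partial i (u + v) = partial i u + partial i v.
Proof. by move=> su sv; apply/funext => x; apply: deriveD; exact: smooth_derivable. Qed.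

Lemma partialZ (k : R) u i : csmooth u -> partial i (k *: u) = k *: partial i u.
Proof. by move=> su; apply/funext => x; apply: deriveZ; exact: smooth_derivable. Qed.

Lemma partialM u v i : csmooth u -> csmooth v ->
  partial i (u * v) = partial i u * v + u * partial i v.
Proof.
move=> su sv; apply/funext => x; rewrite [LHS]deriveM; try exact: smooth_derivable.
by rewrite addrC; congr (_ + _); rewrite [LHS]mulrC.
Qed.

Lemma partial_cst (k : R) i : partial i (cst k) = 0.
Proof. by apply/funext => x; exact: derive_cst. Qed.

Lemma smooth_cst (k : R) : csmooth (cst k : Rd -> R).
Proof.
apply: (@smooth_class (range (fun k : R => cst k : Rd -> R))); last by exists k.
move=> _ [c _ <-]; split=> [|i x|i]; [exact: cst_continuous|exact: derivable_cst|].
by rewrite partial_cst; exists 0.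
Qed.

(** Leibniz' rule turns a product into a sum of products, so the class must be closed under both
    operations to be stable under derivation. *)
Inductive smooth_alg : (Rd -> R) -> Prop :=
| smooth_alg1 u : csmooth u -> smooth_alg u
| smooth_algD u v : smooth_alg u -> smooth_alg v -> smooth_alg (u + v)
| smooth_algM u v : smooth_alg u -> smooth_alg v -> smooth_alg (u * v).

Lemma smooth_algP u : smooth_alg u -> csmooth u.
Proof.
apply: smooth_class => {}u.
elim => {u} [u su|u v au [cu du pu] av [cv dv pv]|u v au [cu du pu] av [cv dv pv]].
- split; [exact: smooth_continuous|exact: smooth_derivable|].
  by move=> i; apply/smooth_alg1/smooth_partial.
- split=> [x|i x|i]; [exact: cvgD (cu x) (cv x)|exact: derivableD|].
  suff -> : partial i (u + v) = partial i u + partial i v by exact: smooth_algD.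
  by apply/funext => x; apply: deriveD; [exact: du|exact: dv].
- split=> [x|i x|i]; [exact: cvgM (cu x) (cv x)|exact: derivableM|].
  suff -> : partial i (u * v) = partial i u * v + u * partial i v.
    by apply: smooth_algD; exact: smooth_algM.
  apply/funext => x; rewrite [LHS]deriveM; [|exact: du|exact: dv].
  by rewrite addrC; congr (_ + _); rewrite [LHS]mulrC.
Qed.

Lemma smoothD u v : csmooth u -> csmooth v -> csmooth (u + v).
Proof. by move=> su sv; apply/smooth_algP/smooth_algD; exact: smooth_alg1. Qed.

Lemma smoothM u v : csmooth u -> csmooth v -> csmooth (u * v).
Proof. by move=> su sv; apply/smooth_algP/smooth_algM; exact: smooth_alg1. Qed.

Lemma smoothZ (k : R) u : csmooth u -> csmooth (k *: u).
Proof.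
move=> su; rewrite (_ : k *: u = cst k * u)//.
by apply: smoothM => //; exact: smooth_cst.
Qed.

Lemma smoothN u : csmooth u -> csmooth (- u).
Proof. by rewrite -scaleN1r; exact: smoothZ. Qed.

Lemma smoothB u v : csmooth u -> csmooth v -> csmooth (u - v).
Proof. by move=> su sv; apply: smoothD => //; exact: smoothN. Qed.

Lemma smooth_sum (I : Type) (r : seq I) (P : pred I) (F : I -> Rd -> R) :
  (forall k, csmooth (F k)) -> csmooth (\sum_(k <- r | P k) F k).
Proof.
move=> sF; elim/big_ind : _ => //; [exact: (smooth_cst 0)|exact: smoothD].
Qed.

Lemma partial_sum (I : Type) (r : seq I) (P : pred I) (F : I -> Rd -> R) i :
  (forall k, csmooth (F k)) ->
  partial i (\sum_(k <- r | P k) F k) = \sum_(k <- r | P k) partial i (F k).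
Proof.
move=> sF; elim: r => [|k r IH]; first by rewrite !big_nil (partial_cst 0).
rewrite !big_cons; case: (P k) => //; rewrite partialD// ?IH//.
exact: smooth_sum.
Qed.

Lemma continuous_affine z (t : R) : continuous (fun y : Rd => z + t *: y).
Proof.
move=> y; apply: (@continuousD R Rd Rd (cst z) (fun y => t *: y)).
  exact: cst_continuous.
by apply: continuousZl_tmp; exact: cvg_id.
Qed.

Lemma is_derive_affine u z (t : R) i x : csmooth u ->
  is_derive x 'e_i (fun y => u (z + t *: y)) (t * partial i u (z + t *: x)).
Proof.
move=> su; have := is_derive_scale t (is_derive_partial i (z + t *: x) su).
rewrite (is_derive_epsP u) (is_derive_epsP (fun y => u (z + t *: y))) => H e e0.
have [r r0 rP] := H e e0; exists r => // h h0 hr; have := rP h h0 hr.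
by rewrite scalerDr addrA !scalerA [t * h]mulrC.
Qed.

Lemma partial_affine u z (t : R) i : csmooth u ->
  partial i (fun y => u (z + t *: y)) = t *: (fun y => partial i u (z + t *: y)).
Proof. by move=> su; apply/funext => x; have [] := is_derive_affine z t i x su. Qed.

Lemma smooth_affine u z (t : R) : csmooth u -> csmooth (fun y => u (z + t *: y)).
Proof.
move=> su; apply: (@smooth_class [set v | exists (u : Rd -> R) (k : R), csmooth u /\
    v = k *: (fun y => u (z + t *: y))]); last first.
  by exists u, 1; rewrite scale1r.
move=> _ [{}u [k [{}su ->]]].
have du i x : derivable (fun y => u (z + t *: y)) x 'e_i.
  by have [] := is_derive_affine z t i x su.
split=> [x|i x|i]; [|exact: derivableZ|].
  apply: (@continuousM R Rd (cst k) (fun y => u (z + t *: y))).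
    exact: cst_continuous.
  apply: (@continuous_comp _ _ _ (fun y : Rd => z + t *: y) u).
    exact: continuous_affine.
  exact: smooth_continuous.
exists (partial i u), (k * t); split; first exact: smooth_partial.
rewrite -scalerA -partial_affine//; apply/funext => x; exact: deriveZ.
Qed.

Lemma Dw_affine w u z (t : R) : csmooth u ->
  Dw w (fun y => u (z + t *: y)) = t ^+ size w *: (fun y => Dw w u (z + t *: y)).
Proof.
move=> su; elim: w => [|i w IH]; first by rewrite expr0 scale1r.
rewrite Dw_cons IH partialZ; last exact/smooth_affine/smooth_Dw.
rewrite partial_affine; last exact/smooth_Dw.
by rewrite scalerA -exprSr.
Qed.

Lemma DwD w u v : csmooth u -> csmooth v -> Dw w (u + v) = Dw w u + Dw w v.
Proof.
move=> su sv; elim: w => // i w IH; rewrite !Dw_cons IH partialD//; exact: smooth_Dw.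
Qed.

Lemma DwZ w (k : R) u : csmooth u -> Dw w (k *: u) = k *: Dw w u.
Proof. by move=> su; elim: w => // i w IH; rewrite !Dw_cons IH partialZ//; exact: smooth_Dw. Qed.

Lemma Dw_cst w (k : R) : Dw w (cst k) = if w is [::] then cst k else 0.
Proof.
elim: w => // i w IH; rewrite Dw_cons IH.
by case: w {IH} => [|j w]; [exact: partial_cst|exact: (partial_cst 0)].
Qed.

Lemma Dw_perm w w' u : csmooth u -> perm_eq w w' -> Dw w u = Dw w' u.
Proof.
move=> su; elim: w w' => [|i w IH] w' pw.
  by move: pw; rewrite perm_sym => /perm_nilP ->.
have : i \in w' by rewrite -(perm_mem pw) mem_head.
move=> iw; case/splitPr: iw pw => w1 w2.
rewrite perm_sym -(cat1s i w2) perm_catCA /= perm_cons perm_sym => pw.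
rewrite Dw_cons (IH _ pw) -Dw_cons.
elim: w1 {pw} => // j w1 IH1; rewrite !cat_cons !Dw_cons -IH1 Dw_cons partialC//.
exact: smooth_Dw.
Qed.

Definition coordf i : Rd -> R := fun y => y ord0 i.

Lemma is_derive_coord i x (v : Rd) : is_derive x v (coordf i) (v ord0 i).
Proof.
apply/is_derive_epsP => e e0; exists 1 => // h h0 _.
by rewrite /coordf !mxE addrAC subrr add0r mulKf// subrr normr0.
Qed.

Lemma partial_coord i j : partial j (coordf i) = cst ((i == j)%:R).
Proof.
apply/funext => x; have [_] := is_derive_coord i x 'e_j.
by rewrite /partial => ->; rewrite mxE eqxx.
Qed.

Lemma smooth_coord i : csmooth (coordf i).
Proof.
apply: (@smooth_class [set u | u = coordf i \/ csmooth u]); last by left.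
move=> u [->|su].
  split=> [|j x|j]; [exact: coord_continuous|by have [] := is_derive_coord i x 'e_j|].
  by right; rewrite partial_coord; exact: smooth_cst.
split; [exact: smooth_continuous|exact: smooth_derivable|].
by move=> j; right; exact: smooth_partial.
Qed.

(** Stands in for the weighted seminorms: being pointwise, it involves no supremum, and the weight
    [p] is easily changed. *)
Definition bd K u (p : Rd -> R) := forall w, (size w <= K)%N -> forall y, `|Dw w u y| <= p y.

Lemma bd_le K u p q : bd K u p -> (forall y, p y <= q y) -> bd K u q.
Proof. by move=> up pq w wK y; apply: le_trans (pq y); exact: up. Qed.

Lemma bdS K u p : bd K.+1 u p <->
  (forall y, `|u y| <= p y) /\ forall i, bd K (partial i u) p.
Proof.
split=> [H|[H0 H] w].
  split=> [|i w wK]; first exact: (H [::]).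
  by rewrite -Dw_rcons; apply: H; rewrite size_rcons.
by case/lastP: w => [//|w i]; rewrite size_rcons Dw_rcons ltnS => wK; exact: H.
Qed.

Lemma bdD K u v p q : csmooth u -> csmooth v ->
  bd K u p -> bd K v q -> bd K (u + v) (p + q).
Proof.
move=> su sv up vq w wK y; rewrite DwD//.
by rewrite (le_trans (ler_normD _ _))// lerD ?up ?vq.
Qed.

(** Each derivative splits the product into two terms, whence 2^K terms after K derivatives. *)
Lemma bdM K u v p q : csmooth u -> csmooth v ->
  bd K u p -> bd K v q -> bd K (u * v) (2 ^+ K *: (p * q)).
Proof.
elim: K u v => [|K IH] u v su sv up vq.
  move=> w; rewrite leqn0 size_eq0 => /eqP -> y; rewrite expr0 scale1r normrM.
  by apply: ler_pM => //; [exact: (up [::])|exact: (vq [::])].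
move/bdS : (up) => [u0 up']; move/bdS: (vq) => [v0 vq'].
have upK : bd K u p by move=> w wK; apply: up; exact: leqW.
have vqK : bd K v q by move=> w wK; apply: vq; exact: leqW.
apply/bdS; split=> [y|i].
  apply: (@le_trans _ _ (p y * q y)); first by rewrite normrM ler_pM.
  rewrite -[leLHS]mul1r [leRHS]/(2 ^+ K.+1 * (p y * q y)) ler_wpM2r//.
    by rewrite mulr_ge0// (le_trans _ (u0 y), le_trans _ (v0 y)).
  by rewrite exprn_ege1// ler1n.
rewrite partialM//; have -> : 2 ^+ K.+1 *: (p * q) = 2 ^+ K *: (p * q) + 2 ^+ K *: (p * q).
  by rewrite exprS mulr_natl -scalerMnl mulr2n.
apply: bdD; [| |apply: IH => //|apply: IH => //]; try apply: smoothM => //; exact: smooth_partial.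
Qed.

End smooth.

(** * Functions of subexponential growth *)

Section growth.
Context (R : realType).

Lemma is_derive_monomial n (c s : R) :
  is_derive s 1 (fun s => c * s ^+ n.+1) (c * (n.+1%:R * s ^+ n)).
Proof.
have H : is_derive s 1 (@GRing.exp R ^~ n.+1) (n.+1%:R * s ^+ n).
  apply: DeriveDef; first exact: exprn_derivable.
  by rewrite exp_derive [LHS]mulr1.
exact: is_deriveZ.
Qed.

(** Integrates the bound on [dh] without integrals: by the mean value theorem C s^(n+1) / (n+1) -
    h(s) is at least as large at 1 as at 0; likewise for -h. *)
Lemma growth_step (h dh : R -> R) n (C : R) :
  (forall s : R, is_derive s 1 h (dh s)) -> h 0 = 0 ->
  (forall s, 0 <= s <= 1 -> `|dh s| <= C * s ^+ n) -> `|h 1| <= C / n.+1%:R.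
Proof.
have key (g dg : R -> R) : (forall s : R, is_derive s 1 g (dg s)) -> g 0 = 0 ->
    (forall s, 0 <= s <= 1 -> `|dg s| <= C * s ^+ n) -> g 1 <= C / n.+1%:R.
  move=> gE g0 gC.
  pose G (s : R) : R := (C / n.+1%:R) * s ^+ n.+1 - g s.
  have GE (s : R) : is_derive s 1 G (C * s ^+ n - dg s).
    have -> : C * s ^+ n = (C / n.+1%:R) * (n.+1%:R * s ^+ n).
      by rewrite mulrA divfK// pnatr_eq0.
    by apply: is_deriveB; exact: is_derive_monomial.
  have cG : continuous G.
    move=> x; apply: differentiable_continuous; apply/derivable1_diffP.
    by have [] := GE x.
  have [c c01] := @MVT_segment _ G _ 0 1 ler01 (fun s _ => GE s) (continuous_subspaceT cG).
  rewrite /G g0 expr1n expr0n/= !mulr0 !subr0 !mulr1 => E.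
  rewrite -subr_ge0 E subr_ge0; move: c01; rewrite in_itv/= => /gC.
  exact: le_trans (ler_norm _).
move=> hE h0 hC; rewrite ler_norml; apply/andP; split; last exact: key hE _ _.
rewrite lerNl; apply: (key (fun s => - h s) (fun s => - dh s) _ _ _).
- by rewrite h0 oppr0.
- by move=> s /hC; rewrite normrN.
Qed.

Lemma exprn_le_expR n (x : R) : 0 <= x -> x ^+ n / n`!%:R <= expR x.
Proof.
case: n => [|n] x0; first by rewrite expr0 fact0 divr1 -expR0 ler_expR.
by rewrite (le_trans _ (expR_ge1Dxn n x0))// lerDr.
Qed.

(** With N = n + 1, 1 + x <= N/e (1 + e x / N) <= N/e exp (e x / N), because e <= 1 <= N; then raise
    to the power n <= N. Taking N instead of n covers n = 0. *)
Lemma poly_le_expR n (e x : R) : 0 < e -> e <= 1 -> 0 <= x ->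
  (1 + x) ^+ n <= (n.+1%:R / e) ^+ n * expR (e * x).
Proof.
move=> e0 e1 x0; have n0 : 0 < n.+1%:R :> R by rewrite ltr0n.
apply: (@le_trans _ _ ((n.+1%:R / e * expR (e / n.+1%:R * x)) ^+ n)).
  apply: lerXn2r; rewrite ?nnegrE; first by rewrite addr_ge0.
    by rewrite mulr_ge0 ?expR_ge0 ?divr_ge0 ?ltW.
  apply: (@le_trans _ _ (n.+1%:R / e * (1 + e / n.+1%:R * x))).
    rewrite mulrDr mulr1 mulrA [_ * (e / _)]mulrA divfK ?lt0r_neq0// divff ?lt0r_neq0//.
    by rewrite mul1r lerD2r ler_pdivlMr// mul1r (le_trans e1)// ler1n.
  by apply: ler_wpM2l; [rewrite divr_ge0 ?ltW|exact: expR_ge1Dx].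
rewrite exprMn; apply: ler_wpM2l; first by rewrite exprn_ge0 ?divr_ge0 ?ltW.
rewrite -expRM_natl ler_expR.
rewrite mulrA ler_wpM2r// mulrCA -[leRHS]mulr1 ler_wpM2l ?(ltW e0)//.
by rewrite ler_pdivrMr// mul1r ler_nat.
Qed.

End growth.

Section tame.
Context (R : realType) (d : nat).
Local Notation Rd := 'rV[R]_d.
Implicit Types (u v : Rd -> R) (x y z : Rd) (i j : 'I_d) (w : seq 'I_d).
Local Notation "'e_ i" := (delta_mx ord0 i : Rd) (at level 8, i at level 2).

Lemma bd_words u (p : Rd -> R) K : (forall y, 0 <= p y) ->
  (forall w, exists M, forall y, `|Dw w u y| <= M * p y) ->
  exists2 M, 0 <= M & bd K u (fun y => M * p y).
Proof.
move=> p0; elim: K u => [|K IH] u up.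
  have [M MP] := up [::]; exists `|M| => // w; rewrite leqn0 size_eq0 => /eqP -> y.
  by rewrite (le_trans (MP y))// ler_wpM2r// ler_norm.
have [M0 M0P] := up [::].
have /choice[M MP] i : exists M, 0 <= M /\ bd K (partial i u) (fun y => M * p y).
  have [|M] := IH (partial i u); last by exists M.
  by move=> w; have [M MP] := up (rcons w i); exists M; rewrite -Dw_rcons.
exists (`|M0| + \sum_i M i); first by rewrite addr_ge0// sumr_ge0// => i _; case: (MP i).
apply/bdS; split=> [y|i].
  rewrite (le_trans (M0P y))// ler_wpM2r// (le_trans (ler_norm M0))// lerDl.
  by rewrite sumr_ge0// => i _; case: (MP i).
have [Mi0 MiP] := MP i; apply: bd_le MiP _ => y.
rewrite ler_wpM2r// (bigD1 i)//= addrCA lerDl addr_ge0// sumr_ge0// => j _.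
by case: (MP j).
Qed.

(** Subexponential growth of all derivatives amounts to membership in every P_gamma, and is stable
    under products, which a fixed P_gamma is not: each factor is allotted half of the exponent. *)
Variant tame u : Prop := Tame of csmooth u & forall K (e : R), 0 < e ->
  exists2 M, 0 <= M & bd K u (fun y => M * expR (e * norm1 y)).

Lemma tame_smooth u : tame u -> csmooth u. Proof. by case. Qed.

Lemma tame_bd u K e : tame u -> 0 < e ->
  exists2 M, 0 <= M & bd K u (fun y => M * expR (e * norm1 y)).
Proof. by case=> _ H; exact: H. Qed.

Lemma tameD u v : tame u -> tame v -> tame (u + v).
Proof.
move=> tu tv; have su := tame_smooth tu; have sv := tame_smooth tv.
split=> [|K e e0]; first exact: smoothD.
have [M M0 MP] := tame_bd K tu e0; have [L L0 LP] := tame_bd K tv e0.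
exists (M + L); first by rewrite addr_ge0.
by apply: bd_le (bdD su sv MP LP) _ => y; rewrite mulrDl.
Qed.

Lemma tameM u v : tame u -> tame v -> tame (u * v).
Proof.
move=> tu tv; have su := tame_smooth tu; have sv := tame_smooth tv.
split=> [|K e e0]; first exact: smoothM.
have e2 : 0 < e / 2 by rewrite divr_gt0.
have [M M0 MP] := tame_bd K tu e2; have [L L0 LP] := tame_bd K tv e2.
exists (2 ^+ K * (M * L)); first by rewrite !mulr_ge0// exprn_ge0.
apply: bd_le (bdM su sv MP LP) _ => y.
rewrite -[leLHS]/(2 ^+ K * ((M * expR (e / 2 * norm1 y)) * (L * expR (e / 2 * norm1 y)))).
have -> : e * norm1 y = e / 2 * norm1 y + e / 2 * norm1 y by rewrite -mulrDl -splitr.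
rewrite expRD; move: (expR _) => E; rewrite le_eqVlt; apply/orP; left; apply/eqP; ring.
Qed.

Lemma tame_bounded u (M : R) : csmooth u -> (forall w y, `|Dw w u y| <= M) -> tame u.
Proof.
move=> su uM; split=> // K e e0; exists `|M| => // w _ y.
rewrite (le_trans (uM w y))// (le_trans (ler_norm _))// ler_peMr//.
by rewrite -expR0 ler_expR mulr_ge0 ?(ltW e0) ?norm1_ge0.
Qed.

Lemma tame_cst (k : R) : tame (cst k).
Proof.
apply: (@tame_bounded _ `|k|); first exact: smooth_cst.
by move=> [|i w] y; rewrite Dw_cst//= normr0.
Qed.

Lemma tameZ (k : R) u : tame u -> tame (k *: u).
Proof. by move=> tu; rewrite (_ : k *: u = cst k * u)//; apply: tameM => //; exact: tame_cst. Qed.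

Lemma tameN u : tame u -> tame (- u).
Proof. by rewrite -scaleN1r; exact: tameZ. Qed.

Lemma tameB u v : tame u -> tame v -> tame (u - v).
Proof. by move=> su sv; apply: tameD => //; exact: tameN. Qed.

Lemma tame_sum (I : Type) (r : seq I) (P : pred I) (F : I -> Rd -> R) :
  (forall k, tame (F k)) -> tame (\sum_(k <- r | P k) F k).
Proof.
move=> sF; elim/big_ind : _ => //; [exact: (tame_cst 0)|exact: tameD].
Qed.

Lemma tame_prod (I : Type) (r : seq I) (P : pred I) (F : I -> Rd -> R) :
  (forall k, tame (F k)) -> tame (\prod_(k <- r | P k) F k).
Proof.
move=> sF; elim/big_ind : _ => //; [exact: (tame_cst 1)|exact: tameM].
Qed.

Lemma tame_coord i : tame (coordf i).
Proof.
split=> [|K e e0]; first exact: smooth_coord.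
(* The term [e^-1] bounds the coordinate, by [e * norm1 y <= expR (e * norm1 y)]; the term 1 bounds
   its derivatives. *)
exists (1 + e^-1); first by rewrite addr_ge0// invr_ge0 ltW.
have eE y : 1 + e * norm1 y <= expR (e * norm1 y) by exact: expR_ge1Dx.
have ey y : 0 <= e * norm1 y by rewrite mulr_ge0 ?(ltW e0) ?norm1_ge0.
move=> w _ y; case/lastP: w => [|w j].
  apply: (le_trans (coord_norm1 y i)).
  have := eE y; move: (expR (e * norm1 y)) => E; have := norm1_ge0 y; move: (norm1 y) => N N0 NE.
  have : e^-1 * (e * N) <= e^-1 * E by apply: ler_wpM2l; [rewrite invr_ge0 ltW|lra].
  rewrite mulKf ?lt0r_neq0// => /le_trans; apply; rewrite mulrDl mul1r lerDr.
  by rewrite (le_trans _ NE)// addr_ge0// mulr_ge0// ltW.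
rewrite Dw_rcons partial_coord Dw_cst.
apply: (@le_trans _ _ 1).
  by case: w => [|k w] /=; rewrite ?normr0 ?ler01//; case: eqP; rewrite ?normr1 ?normr0.
have := eE y; have := ey y; have : 0 <= e^-1 * expR (e * norm1 y).
  by rewrite mulr_ge0 ?expR_ge0 ?invr_ge0 ?ltW.
rewrite mulrDl mul1r; lra.
Qed.

Lemma tame_affine u z (t : R) : tame u -> tame (fun y => u (z + t *: y)).
Proof.
move=> tu; have su := tame_smooth tu; split=> [|K e e0]; first exact: smooth_affine.
have t1 : 0 < `|t| + 1 by rewrite ltr_wpDl.
have e1 : 0 < e / (`|t| + 1) by rewrite divr_gt0.
have [M M0 MP] := tame_bd K tu e1.
exists ((`|t| + 1) ^+ K * (M * expR (e / (`|t| + 1) * norm1 z))).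
  by rewrite !mulr_ge0// ?expR_ge0// exprn_ge0// ltW.
move=> w wK y; rewrite Dw_affine//.
rewrite -[leLHS]/(`|t ^+ size w * Dw w u (z + t *: y)|) normrM -!mulrA.
apply: ler_pM => //.
  rewrite normrX (@le_trans _ _ ((`|t| + 1) ^+ size w))//.
    by rewrite lerXn2r ?nnegrE ?addr_ge0// lerDl.
  by rewrite ler_weXn2l// lerDr.
rewrite (le_trans (MP w wK _))// ler_wpM2l// -expRD ler_expR.
rewrite [e * (_ * _)]mulrA -lerBlDl -mulrBr.
have -> : e * norm1 y = e / (`|t| + 1) * ((`|t| + 1) * norm1 y).
  by rewrite mulrA divfK ?lt0r_neq0.
rewrite ler_wpM2l ?(ltW e1)//.
rewrite lerBlDl (le_trans (norm1D _ _))// lerD2l norm1Z ler_wpM2r ?norm1_ge0//.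
by rewrite lerDl.
Qed.

End tame.

(** * Taylor expansion with exponential bounds *)

Section taylor.
Context (R : realType) (d : nat).
Local Notation Rd := 'rV[R]_d.
Implicit Types (u v : Rd -> R) (x y z : Rd) (i j : 'I_d) (w : seq 'I_d).
Local Notation "'e_ i" := (delta_mx ord0 i : Rd) (at level 8, i at level 2).

(* [tform k u z y] is the value at (y, ..., y) of the k-th derivative of u at z. *)
Fixpoint tform k u z : Rd -> R :=
  if k is l.+1 then \sum_i coordf i * tform l (partial i u) z else cst (u z).

Lemma tame_tform k u z : tame (tform k u z).
Proof.
elim: k u => [|k IH] u /=; first exact: tame_cst.
by apply: tame_sum => i; apply: tameM; [exact: tame_coord|exact: IH].
Qed.

Lemma tformSE k u z y : tform k.+1 u z y = \sum_i y ord0 i * tform k (partial i u) z y.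
Proof. by rewrite /= fct_sumE. Qed.

Lemma tformZ k u z (t : R) y : tform k u z (t *: y) = t ^+ k * tform k u z y.
Proof.
elim: k u => [|k IH] u; first by rewrite mul1r.
rewrite !tformSE mulr_sumr; apply: eq_bigr => i _.
by rewrite IH mxE exprS; ring.
Qed.

Lemma partial_tform0 j u z : partial j (tform 0 u z) = 0.
Proof. exact: partial_cst. Qed.

(** Derivation meets each of the k + 1 equal arguments of the symmetric form once; the symmetry is
    [partialC]. *)
Lemma partial_tformS j k u z : csmooth u ->
  partial j (tform k.+1 u z) = k.+1%:R *: tform k (partial j u) z.
Proof.
have sT l v : csmooth (tform l v z) by apply/tame_smooth/tame_tform.
have sC i : csmooth (coordf i : Rd -> R) by exact: smooth_coord.
have E l v : partial j (tform l.+1 v z) =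
    tform l (partial j v) z + \sum_i coordf i * partial j (tform l (partial i v) z).
  rewrite [tform l.+1 _ _]/= partial_sum; last by move=> i; exact: smoothM.
  rewrite (eq_bigr (fun i => partial j (coordf i) * tform l (partial i v) z +
    coordf i * partial j (tform l (partial i v) z))); last by move=> i _; exact: partialM.
  rewrite big_split/=; congr (_ + _).
  rewrite (bigD1 j)//= big1 ?addr0.
    by rewrite partial_coord eqxx; apply/funext => y; exact: mul1r.
  move=> i ij; rewrite partial_coord (negPf ij); apply/funext => y; exact: mul0r.
elim: k u => [|k IH] u su.
  rewrite E scale1r big1 ?addr0// => i _.
  by rewrite partial_tform0 mulr0.
rewrite E; transitivity (tform k.+1 (partial j u) z + k.+1%:R *: tform k.+1 (partial j u) z).
  congr (_ + _); rewrite [in RHS]/= scaler_sumr; apply: eq_bigr => i _.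
  rewrite IH; last exact: smooth_partial.
  by rewrite (partialC j i su); apply/funext => y; exact: mulrCA.
by rewrite -[k.+2%:R]natr1 scalerDl scale1r addrC.
Qed.

Definition taylor n u z : Rd -> R := \sum_(k < n) (k`!%:R)^-1 *: tform k u z.

Definition trem n u z : Rd -> R := (fun y => u (z + 1 *: y)) - taylor n u z.

Lemma tame_taylor n u z : tame (taylor n u z).
Proof. by apply: tame_sum => k; apply/tameZ/tame_tform. Qed.

Lemma smooth_trem n u z : csmooth u -> csmooth (trem n u z).
Proof.
move=> su; apply: smoothB; first exact: smooth_affine.
exact/tame_smooth/tame_taylor.
Qed.

Lemma tame_trem n u z : tame u -> tame (trem n u z).
Proof. by move=> tu; apply: tameB; [exact: tame_affine|exact: tame_taylor]. Qed.

Lemma partial_trem j n u z : csmooth u ->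
  partial j (trem n u z) = trem n.-1 (partial j u) z.
Proof.
move=> su; rewrite /trem -scaleN1r partialD; last 2 first.
- exact: smooth_affine.
- exact/smoothZ/tame_smooth/tame_taylor.
rewrite partialZ; last exact/tame_smooth/tame_taylor.
rewrite partial_affine// scale1r scaleN1r; congr (_ - _).
rewrite /taylor partial_sum; last by move=> k; apply/smoothZ/tame_smooth/tame_tform.
have H k : partial j ((k`!%:R)^-1 *: tform k u z) =
    (k`!%:R)^-1 *: partial j (tform k u z) by apply/partialZ/tame_smooth/tame_tform.
under eq_bigr do rewrite H.
case: n => [|n]; first by rewrite !big_ord0.
rewrite big_ord_recl partial_tform0 scaler0 add0r; apply: eq_bigr => k _.
rewrite lift0 partial_tformS// scalerA; congr (_ *: _).
rewrite factS natrM invfM mulrAC mulVf ?mul1r ?pnatr_eq0//.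
Qed.

(** A derivative of a remainder is the remainder, of lower order, of the derivative. The subtraction
    is truncated: from [n] letters on, the Taylor polynomial is gone. *)
Lemma Dw_trem w n u z : csmooth u ->
  Dw w (trem n u z) = trem (n - size w) (Dw w u) z.
Proof.
move=> su; elim: w => [|i w IH]; first by rewrite subn0.
by rewrite !Dw_cons IH partial_trem ?subnS//; exact: smooth_Dw.
Qed.

Lemma trem0 n u z : trem n.+1 u z 0 = 0.
Proof.
rewrite /trem /taylor -[LHS]/(u (z + 1 *: 0) - (\sum_(k < n.+1) (k`!%:R)^-1 *: tform k u z) 0).
rewrite scaler0 addr0 fct_sumE big_ord_recl big1 ?addr0.
  by rewrite -[X in _ - X]/((1%:R)^-1 * u z) invr1 mul1r subrr.
move=> k _; rewrite -[LHS]/((_`!%:R)^-1 * tform (lift ord0 k) u z 0) lift0 tformSE.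
by rewrite big1 ?mulr0// => i _; rewrite mxE mul0r.
Qed.

(** Along the segment from 0 to [v], the derivative of the remainder of order n + 1 is a combination
    of remainders of order n of the partial derivatives. Integrating the inductive bound,
    proportional to s^n, produces the next factor of the factorial. *)
Lemma trem_bound n u z (v : Rd) (M e : R) : csmooth u -> 0 <= M -> 0 <= e ->
  (forall w x, size w = n -> `|Dw w u x| <= M * expR (e * norm1 x)) ->
  `|trem n u z v| <= M * norm1 v ^+ n / n`!%:R * expR (e * (norm1 z + norm1 v)).
Proof.
move=> + M0 e0; elim: n u v => [|n IH] u v su uM.
  rewrite expr0 divr1 mulr1 /trem /taylor big_ord0 subr0.
  rewrite scale1r (le_trans (uM [::] _ _))// ler_wpM2l// ler_expR ler_wpM2l//.
  exact: norm1D.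
pose h (s : R) := trem n.+1 u z (0 + s *: v).
pose dh (s : R) := \sum_i v ord0 i * partial i (trem n.+1 u z) (0 + s *: v).
have hE (s : R) : is_derive s 1 h (dh s).
  by apply: is_derive_smooth_line; exact: smooth_trem.
have h0 : h 0 = 0 by rewrite /h scale0r addr0 trem0.
pose C := M * norm1 v ^+ n.+1 / n`!%:R * expR (e * (norm1 z + norm1 v)).
have dhC (s : R) : 0 <= s <= 1 -> `|dh s| <= C * s ^+ n.
  move=> /andP[s0 s1].
  have sv : norm1 (0 + s *: v) = s * norm1 v by rewrite add0r norm1Z ger0_norm.
  have Nv := norm1_ge0 v.
  have b i : `|partial i (trem n.+1 u z) (0 + s *: v)| <=
      M * (norm1 v ^+ n * s ^+ n) / n`!%:R * expR (e * (norm1 z + norm1 v)).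
    rewrite partial_trem//= (le_trans (IH (partial i u) _ _ _)) //.
    - exact: smooth_partial.
    - by move=> w x wn; rewrite -Dw_rcons uM// size_rcons wn.
    - rewrite sv exprMn [s ^+ n * _]mulrC ler_wpM2l//.
        by rewrite divr_ge0// !mulr_ge0// exprn_ge0.
      by rewrite ler_expR ler_wpM2l// lerD2l ler_piMl.
  rewrite /dh (le_trans (ler_norm_sum _ _ _))//.
  have -> : C * s ^+ n = \sum_i `|v ord0 i| *
      (M * (norm1 v ^+ n * s ^+ n) / n`!%:R * expR (e * (norm1 z + norm1 v))).
    by rewrite -mulr_suml -/(norm1 v) /C exprS; ring.
  by apply: ler_sum => i _; rewrite normrM ler_wpM2l.
have := growth_step hE h0 dhC; rewrite /h scale1r add0r => /le_trans; apply.
rewrite /C factS natrM invfM le_eqVlt; apply/orP; left; apply/eqP.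
by move: (n`!%:R)^-1 (n.+1%:R)^-1 => a b; ring.
Qed.

Definition dtrem n u z (t : R) : Rd -> R := fun y => trem n u z (0 + t *: y).

Lemma tame_dtrem n u z t : tame u -> tame (dtrem n u z t).
Proof. by move=> tu; apply: tame_affine; exact: tame_trem. Qed.

Lemma taylor_expansion n u z (t : R) :
  (fun y => u (z + t *: y)) =
  \sum_(k < n) (t ^+ k / k`!%:R) *: tform k u z + dtrem n u z t.
Proof.
apply/funext => y; rewrite /dtrem /trem /taylor.
rewrite -[RHS]/((\sum_(k < n) (t ^+ k / k`!%:R) *: tform k u z) y +
  (u (z + 1 *: (0 + t *: y)) - (\sum_(k < n) (k`!%:R)^-1 *: tform k u z) (0 + t *: y))).
rewrite scale1r add0r !fct_sumE.
have -> : \sum_(k < n) ((t ^+ k / k`!%:R) *: tform k u z) y =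
    \sum_(k < n) ((k`!%:R)^-1 *: tform k u z) (t *: y).
  apply: eq_bigr => k _; rewrite -[LHS]/(t ^+ k / k`!%:R * tform k u z y).
  by rewrite -[RHS]/((k`!%:R)^-1 * tform k u z (t *: y)) tformZ mulrCA mulrA.
by rewrite [RHS]addrC subrK.
Qed.

(** The remainder of order n - |w| of [Dw w u] involves derivatives of [u] of total order (n - |w|)
    + |w|, which is max (n, |w|) for truncated subtraction. *)
Lemma Dw_dtrem_bound w n u z y (t M e : R) : csmooth u -> 0 <= M -> 0 <= e -> `|t| <= 1 ->
  (forall w' x, size w' = maxn n (size w) -> `|Dw w' u x| <= M * expR (e * norm1 x)) ->
  `|Dw w (dtrem n u z t) y| <= `|t| ^+ size w *
     (M * (`|t| * norm1 y) ^+ (n - size w) / (n - size w)`!%:R *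
       expR (e * (norm1 z + `|t| * norm1 y))).
Proof.
move=> su M0 e0 t1 uM; rewrite /dtrem Dw_affine; last exact: smooth_trem.
rewrite -[leLHS]/(`|t ^+ size w * Dw w (trem n u z) (0 + t *: y)|) normrM normrX.
rewrite Dw_trem// add0r ler_wpM2l ?exprn_ge0// -norm1Z.
apply: trem_bound => //; first exact: smooth_Dw.
by move=> w' x w'E; rewrite -Dw_cat uM// size_cat w'E maxnC maxnE addnC.
Qed.

(** The full power |t|^n survives derivation: a word w gains |w| factors from the chain rule and
    keeps n - |w| in the remainder. *)
Lemma bd_dtrem K n u z (t M e : R) : csmooth u -> 0 <= M -> 0 <= e -> `|t| <= 1 ->
  bd (n + K) u (fun y => M * expR (e * norm1 y)) ->
  bd K (dtrem n u z t) (fun y => `|t| ^+ n * (M * expR (e * norm1 z)) *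
    ((1 + norm1 y) ^+ n * expR (e * norm1 y))).
Proof.
move=> su M0 e0 t1 uM w wK y; have Ny := norm1_ge0 y.
have uM' w' x : size w' = maxn n (size w) -> `|Dw w' u x| <= M * expR (e * norm1 x).
  move=> E; apply: uM; rewrite E geq_max leq_addr/=.
  by rewrite (leq_trans wK)// leq_addl.
apply: le_trans (Dw_dtrem_bound z y su M0 e0 t1 uM') _.
rewrite exprMn mulrDr expRD.
have -> : forall a b c f g h i : R,
    a * (b * (c * f) / g * (h * i)) = (a * c) * (b * h) * (f / g * i).
  by move=> *; ring.
apply: ler_pM; rewrite ?mulr_ge0 ?exprn_ge0 ?expR_ge0 ?invr_ge0//.
  rewrite ler_wpM2r ?mulr_ge0 ?expR_ge0// -exprD.
  by rewrite ler_wiXn2l// -maxnE leq_maxr.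
apply: ler_pM; rewrite ?mulr_ge0 ?exprn_ge0 ?expR_ge0 ?invr_ge0//; last first.
  by rewrite ler_expR ler_wpM2l// ler_piMl.
apply: (@le_trans _ _ (norm1 y ^+ (n - size w))).
  by rewrite ler_piMr ?exprn_ge0// invf_le1 ?ler1n ?ltr0n fact_gt0.
apply: (@le_trans _ _ ((1 + norm1 y) ^+ (n - size w))).
  by apply: lerXn2r; rewrite ?nnegrE ?addr_ge0// lerDr.
by rewrite ler_weXn2l ?leq_subr// lerDl.
Qed.

(** With s = |t| |y|, s^m / m! = 2^-m (2s)^m / m! <= 2^-m exp (2s): geometric decay in the order,
    paid by an exponent proportional to |t|. *)
Lemma bd_dtrem_entire K n u (t : R) : csmooth u -> `|t| <= 1 -> (K <= n)%N ->
  (forall w x, `|Dw w u x| <= 1) ->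
  bd K (dtrem n u 0 t) (fun y => 2^-1 ^+ (n - K) * expR (2 * `|t| * norm1 y)).
Proof.
move=> su t1 Kn uM w wK y; have Ny := norm1_ge0 y.
have uM' w' x : size w' = maxn n (size w) -> `|Dw w' u x| <= 1 * expR (0 * norm1 x).
  by move=> _; rewrite mul0r expR0 mul1r.
apply: le_trans (Dw_dtrem_bound 0 y su ler01 (lexx 0) t1 uM') _.
rewrite mul0r expR0 mulr1 mul1r.
apply: (@le_trans _ _ ((`|t| * norm1 y) ^+ (n - size w) / (n - size w)`!%:R)).
  by rewrite ler_piMl ?exprn_ile1// divr_ge0// exprn_ge0// mulr_ge0.
have := @exprn_le_expR R (n - size w) (2 * `|t| * norm1 y).
rewrite !mulr_ge0// => /(_ isT); rewrite -[2 * _ * _]mulrA exprMn => H.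
apply: (@le_trans _ _ (2^-1 ^+ (n - size w) * expR (2 * (`|t| * norm1 y)))).
  rewrite -(ler_pM2l (exprn_gt0 (n - size w) (ltr0Sn R 1))) [X in _ <= X]mulrA.
  by rewrite -exprMn mulfV ?pnatr_eq0// expr1n mul1r [leLHS]mulrA.
rewrite ler_wpM2r ?expR_ge0// ler_wiXn2l ?invf_le1//; last by rewrite leq_sub2l.
by rewrite ler1n.
Qed.

End taylor.

(** * Continuous functionals and their moments *)

Section dual.
Context (R : realType) (d : nat).
Local Notation Rd := 'rV[R]_d.
Implicit Types (u v : Rd -> R) (x y z : Rd) (i j : 'I_d) (w : seq 'I_d)
  (a : multiindex d).

Definition word a : seq 'I_d := flatten [seq nseq (a i) i | i <- enum 'I_d].

Lemma mpartialE a u : mpartial a u = Dw (word a) u.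
Proof.
rewrite /mpartial /word; elim: (enum 'I_d) => //= i s IH.
by rewrite IH Dw_cat; elim: (a i) => //= n ->.
Qed.

Lemma count_word a i : count_mem i (word a) = a i.
Proof.
rewrite /word count_flatten -map_comp sumnE big_map big_enum/=.
rewrite (bigD1 i)//= count_nseq/= eqxx mul1n big1 ?addn0// => j ji.
by rewrite count_nseq/= (negPf ji).
Qed.

Definition mult w : multiindex d := [ffun i => count_mem i w].

Lemma mult_word a : mult (word a) = a.
Proof. by apply/ffunP => i; rewrite ffunE count_word. Qed.

Lemma mult_perm w w' : (mult w == mult w') = perm_eq w w'.
Proof.
apply/eqP/allP => [E i _|H]; first by apply/eqP; move/ffunP: E => /(_ i); rewrite !ffunE.
apply/ffunP => i; rewrite !ffunE; have /permP -> // : perm_eq w w'.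
by apply/allP.
Qed.

Lemma Dw_mult w u : csmooth u -> Dw w u = mpartial (mult w) u.
Proof.
move=> su; rewrite mpartialE; apply: Dw_perm => //.
by rewrite -mult_perm mult_word.
Qed.

Lemma mdegree_mult w : mdegree (mult w) = size w.
Proof.
rewrite /mdegree (eq_bigr (fun i => count_mem i w)); last by move=> i _; rewrite ffunE.
elim: w => [|i w IH]; first by rewrite big1.
by rewrite big_split/= IH (bigD1 i)//= eqxx big1 ?addn0 ?add1n// => j; rewrite eq_sym => /negPf ->.
Qed.

Lemma size_word a : size (word a) = mdegree a.
Proof. by rewrite -mdegree_mult mult_word. Qed.

Lemma enorm_ge0 x : 0 <= enorm x.
Proof. exact: sqrtr_ge0. Qed.

Lemma coord_enorm x i : `|x ord0 i| <= enorm x.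
Proof.
rewrite /enorm -sqrtr_sqr ler_wsqrtr// (bigD1 i)//= lerDl sumr_ge0// => j _.
exact: sqr_ge0.
Qed.

Lemma enorm_norm1 x : enorm x <= norm1 x.
Proof.
rewrite /enorm -[leRHS]ger0_norm ?norm1_ge0// -sqrtr_sqr ler_wsqrtr//.
rewrite expr2 [X in X * _]/norm1 mulr_suml; apply: ler_sum => i _.
by rewrite -real_normK ?num_real// expr2 ler_wpM2l// coord_norm1.
Qed.

Lemma norm1_enorm x : norm1 x <= d%:R * enorm x.
Proof.
rewrite /norm1 (le_trans (ler_sum _ (fun i _ => coord_enorm x i)))//.
by rewrite sumr_const card_ord mulr_natl.
Qed.

Lemma at_infty_gt (A : set Rd) (r : R) : (forall x, r < enorm x -> A x) -> at_infty A.
Proof.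
move=> rA; rewrite /at_infty /=.
have : \forall M \near +oo_R, r < M by apply: nbhs_pinfty_gt; exact: num_real.
by apply: (@filterS _ +oo_R) => M rM x Mx; apply/rA/(lt_trans rM).
Qed.

Lemma at_inftyP (A : set Rd) : at_infty A -> exists r : R, forall x, r < enorm x -> A x.
Proof.
rewrite /at_infty /= => -[M [_ MA]]; exists (M + 1); apply: MA.
by rewrite ltrDl.
Qed.

Lemma box_compact (r : R) : compact [set x : Rd | forall i, `[- r, r]%classic (x ord0 i)].
Proof.
apply: (@rV_compact R d (fun=> `[- r, r]%classic)) => i.
exact: segment_compact.
Qed.

Lemma continuous_box_bounded u (r : R) : continuous u ->
  exists B : R, forall x, (forall i, `|x ord0 i| <= r) -> `|u x| <= B.
Proof.
move=> cu; have := @compact_bounded _ _ _ (continuous_compact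
  (continuous_subspaceT cu) (@box_compact r)).
move=> [M [_ MP]]; exists (M + 1) => x xr; apply: (MP (M + 1)); first by rewrite ltrDl.
by exists x => // i; rewrite /= in_itv/= -ler_norml.
Qed.

Lemma Pspace_tame (gamma : R) u : 0 < gamma -> tame u -> Pspace gamma u.
Proof.
move=> g0 tu; split; first exact/csmooth_smooth/tame_smooth.
move=> a; apply/cvgrPdist_lt => e e0.
have d0 : 0 < d.+1%:R :> R by rewrite ltr0n.
(* Half of [gamma] pays for the growth of [u], half remains for the decay; d + 1 dominates the
   constant d that compares the two norms, and is never 0. *)
have g1 : 0 < gamma / 2 / d.+1%:R by rewrite !divr_gt0.
have [M M0 MP] := tame_bd (size (word a)) tu g1.
apply: (@at_infty_gt _ (M / e * (2 / gamma))) => x xr.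
rewrite sub0r normrN /expw normrM ger0_norm ?expR_ge0// mpartialE.
have Nx : gamma / 2 / d.+1%:R * norm1 x <= gamma / 2 * enorm x.
  rewrite -mulrA ler_wpM2l ?divr_ge0 ?(ltW g0)// mulrC ler_pdivrMr//.
  rewrite (le_trans (norm1_enorm x))// mulrC ler_wpM2l ?enorm_ge0//.
  by rewrite ler_nat.
apply: (@le_lt_trans _ _ (expR (- gamma * enorm x) * (M * expR (gamma / 2 * enorm x)))).
  rewrite ler_wpM2l ?expR_ge0// (le_trans (MP _ (leqnn _) x))//.
  by rewrite ler_wpM2l// ler_expR.
have -> : - gamma * enorm x = - (gamma / 2 * enorm x) + - (gamma / 2 * enorm x).
  by rewrite -opprD -mulrDl -splitr mulNr.
rewrite expRD expRN.
have EE (E : R) : 0 < E -> E^-1 * E^-1 * (M * E) = M / E.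
  by move=> /lt0r_neq0 E0; field.
rewrite EE ?expR_gt0//.
rewrite ltr_pdivrMr ?expR_gt0// -ltr_pdivrMl// mulrC.
rewrite (lt_le_trans _ (expR_ge1Dx _))//.
rewrite (@lt_trans _ _ (gamma / 2 * enorm x))// ?ltrDr//.
have g2 : 0 < gamma / 2 by rewrite divr_gt0.
move: xr; rewrite -(ltr_pM2l g2); congr (_ < _).
by field; rewrite !lt0r_neq0.
Qed.

Lemma tame_Pall u : Pall u -> tame u.
Proof.
move=> Pu; have su : csmooth u by have [] := Pu 1 ltr01.
split=> // K e e0; apply: bd_words => [y|w]; first exact: expR_ge0.
rewrite Dw_mult//; have [_ /(_ (mult w)) H] := Pu e e0.
have /cvgrPdist_lt /(_ 1 ltr01) /at_inftyP[r rP] := H.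
have [|B BP] := @continuous_box_bounded (mpartial (mult w) u) `|r|.
  by rewrite -Dw_mult//; exact/smooth_continuous/smooth_Dw.
exists (1 + `|B|) => x.
have E1 : 1 <= expR (e * norm1 x).
  by rewrite -expR0 ler_expR mulr_ge0 ?(ltW e0) ?norm1_ge0.
have [xr|rx] := leP (enorm x) `|r|.
  apply: (@le_trans _ _ B).
    by apply: BP => i; exact: le_trans (coord_enorm x i) _.
  rewrite mulrDl ler_wpDl ?mul1r ?expR_ge0//.
  by rewrite (le_trans (ler_norm B))// ler_peMr.
have {}rx : r < enorm x by exact: le_lt_trans (ler_norm r) _.
have := rP x rx; rewrite sub0r normrN /expw normrM ger0_norm ?expR_ge0//.
rewrite mulNr expRN mulrC ltr_pdivrMr ?expR_gt0// mul1r => /ltW /le_trans; apply.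
rewrite mulrDl mul1r (@le_trans _ _ (expR (e * norm1 x)))//.
  by rewrite ler_expR ler_wpM2l ?(ltW e0)// enorm_norm1.
by rewrite lerDl mulr_ge0// expR_ge0.
Qed.

(** Continuity as a single estimate with a fixed order [K] and exponent [e]. It forgets [gamma] and
    is inherited by linear combinations of functionals. *)
Definition tame_dual (T : (Rd -> R) -> R) : Prop :=
  (forall (k : R) u v, tame u -> tame v -> T (k *: u + v) = k * T u + T v) /\
  (exists K (e C : R), [/\ 0 < e, e <= 1, 0 <= C & forall u M, tame u -> 0 <= M ->
    bd K u (fun y => M * expR (e * norm1 y)) -> `|T u| <= C * M]).

Lemma Pdual_tame_dual (gamma : R) T : 0 < gamma -> Pdual gamma T -> tame_dual T.
Proof.
move=> g0 [TL Tc]; have PT u : tame u -> Pspace gamma u by exact: Pspace_tame.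
split=> [k u v tu tv|]; first by apply: TL; exact: PT.
have t0 : tame (0 : Rd -> R) by exact: (tame_cst _ 0).
have T0 : T 0 = 0.
  have := TL 1 0 0 (PT _ t0) (PT _ t0).
  by rewrite scale1r addr0 mul1r => H; apply: (@addrI _ (T 0)); rewrite -H addr0.
have := Tc 0 (PT _ t0); rewrite T0 => /(_ (ball 0 1)) [].
  by apply: nbhsx_ballx.
move=> A [e [e0 Ae]].
pose K := \max_(a <- A) size (word a).
have d0 : 0 < d.+1%:R :> R by rewrite ltr0n.
pose g1 := Num.min 1 (gamma / d.+1%:R).
exists K, g1, (2 / e); split.
- by rewrite lt_min ltr01 divr_gt0.
- by rewrite ge_min lexx.
- by rewrite divr_ge0// ltW.
move=> u M tu M0 uM; apply/ler_addgt0Pr => h h0.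
(* [M] may be 0, while the scaling by e / (2 M') needs a positive number; the excess costs exactly
   [h], as 2 M' / e = 2 M / e + h. *)
pose M' := M + h * e / 2.
have M'0 : 0 < M' by rewrite ltr_wpDl// !mulr_gt0.
suff H : `|T (e / (2 * M') *: u)| < 1.
  have : T (e / (2 * M') *: u) = e / (2 * M') * T u.
    by rewrite -[_ *: u]addr0 TL ?T0 ?addr0//; exact: PT.
  move=> E; move: H; rewrite E normrM gtr0_norm ?divr_gt0// ?mulr_gt0//.
  rewrite mulrC -ltr_pdivlMr ?divr_gt0 ?mulr_gt0// mul1r invf_div => /ltW/le_trans; apply.
  rewrite /M' le_eqVlt; apply/orP; left; apply/eqP; field; exact: lt0r_neq0.
have := Ae (e / (2 * M') *: u); rewrite -ball_normE/= sub0r normrN; apply.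
split; first exact/PT/tameZ.
move=> a aA; apply: (@le_lt_trans _ _ (e / 2)); last by rewrite ltr_pdivrMr// ltr_pMr// ltr1n.
apply: ge_sup; first by exists `|expw gamma (e / (2 * M') *: u - 0) a 0|; exists 0.
move=> _ [x _ <-]; rewrite subr0 /expw mpartialE DwZ; last exact: tame_smooth.
rewrite -[(_ *: _) x]/(e / (2 * M') * Dw (word a) u x).
rewrite mulrCA normrM gtr0_norm ?divr_gt0 ?mulr_gt0//.
have : `|expR (- gamma * enorm x) * Dw (word a) u x| <= M'.
  rewrite normrM ger0_norm ?expR_ge0//.
  apply: (@le_trans _ _ M); last by rewrite lerDl !mulr_ge0// ltW.
  rewrite mulNr expRN mulrC ler_pdivrMr ?expR_gt0//.
  rewrite (le_trans (uM _ _ x))//; first by rewrite /K (big_rem a)//= leq_maxl.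
  rewrite ler_wpM2l// ler_expR.
  apply: (@le_trans _ _ (gamma / d.+1%:R * norm1 x)).
    by rewrite ler_wpM2r ?norm1_ge0// /g1 ge_min lexx orbT.
  rewrite -mulrA ler_wpM2l ?(ltW g0)// mulrC ler_pdivrMr//.
  rewrite (le_trans (norm1_enorm x))// mulrC ler_wpM2l ?enorm_ge0//.
  by rewrite ler_nat.
move=> H; apply: (@le_trans _ _ (e / (2 * M') * M')).
  by rewrite ler_wpM2l ?divr_ge0 ?mulr_ge0 ?(ltW e0) ?(ltW M'0).
by rewrite invfM mulrA divfK ?lt0r_neq0.
Qed.

Lemma tame_dual_sub (c : R) T T' : tame_dual T -> tame_dual T' ->
  tame_dual (fun u => T' u - c * T u).
Proof.
move=> [TL [K [e [C [e0 e1 C0 H]]]]] [TL' [K' [e' [C' [e0' e1' C0' H']]]]]; split.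
  by move=> k u v tu tv; rewrite TL// TL'//; ring.
exists (maxn K K'), (Num.min e e'), (C' + `|c| * C); split.
- by rewrite lt_min e0.
- by rewrite ge_min e1.
- by rewrite addr_ge0// mulr_ge0.
move=> u M tu M0 uM; rewrite (le_trans (ler_normB _ _))// mulrDl lerD//.
  apply: H' => // w wK y; rewrite (le_trans (uM w _ y))//.
    by rewrite (leq_trans wK)// leq_maxr.
  by rewrite ler_wpM2l// ler_expR ler_wpM2r ?norm1_ge0// ge_min lexx orbT.
rewrite normrM -mulrA ler_wpM2l//.
apply: H => // w wK y; rewrite (le_trans (uM w _ y))//.
  by rewrite (leq_trans wK)// leq_maxl.
by rewrite ler_wpM2l// ler_expR ler_wpM2r ?norm1_ge0// ge_min lexx.
Qed.

Section tame_dual_theory.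
Context (T : (Rd -> R) -> R) (tT : tame_dual T).

Lemma tame_dual0 : T 0 = 0.
Proof.
have t0 : tame (0 : Rd -> R) by exact: (tame_cst _ 0).
have := tT.1 (-1) 0 0 t0 t0.
by rewrite scaler0 addr0 mulN1r addNr.
Qed.

Lemma tame_dualZ (k : R) u : tame u -> T (k *: u) = k * T u.
Proof.
by move=> tu; rewrite -[_ *: u]addr0 tT.1 ?tame_dual0 ?addr0//; exact: (tame_cst _ 0).
Qed.

Lemma tame_dualD u v : tame u -> tame v -> T (u + v) = T u + T v.
Proof. by move=> tu tv; rewrite -[in LHS](scale1r u) tT.1// mul1r. Qed.

Lemma tame_dualB u v : tame u -> tame v -> T (u - v) = T u - T v.
Proof. by move=> tu tv; rewrite -scaleN1r addrC tT.1// mulN1r addrC. Qed.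

Lemma tame_dual_sum (I : Type) (r : seq I) (P : pred I) (F : I -> Rd -> R) :
  (forall k, tame (F k)) -> T (\sum_(k <- r | P k) F k) = \sum_(k <- r | P k) T (F k).
Proof.
move=> tF; elim: r => [|k r IH]; first by rewrite !big_nil tame_dual0.
rewrite !big_cons; case: (P k) => //; rewrite tame_dualD// ?IH//.
exact: tame_sum.
Qed.

End tame_dual_theory.

Definition mono w : Rd -> R := \prod_(i <- w) coordf i.

Lemma tame_mono w : tame (mono w).
Proof. by apply: tame_prod => i; exact: tame_coord. Qed.

Lemma mono_cons i w : mono (i :: w) = coordf i * mono w.
Proof. exact: big_cons. Qed.

Fixpoint words n : seq (seq 'I_d) :=
  if n is m.+1 then flatten [seq [seq i :: w | w <- words m] | i <- enum 'I_d]
  else [:: [::]].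

Lemma mem_words n w : (w \in words n) = (size w == n).
Proof.
elim: n w => [|n IH] w; first by rewrite inE size_eq0.
apply/flatten_mapP/idP => [[i _ /mapP[w' w'n ->]]|].
  by rewrite /= eqSS -IH.
case: w => // i w; rewrite /= eqSS -IH => wn.
by exists i; [rewrite mem_enum|exact: map_f].
Qed.

Lemma tform_words n u z : csmooth u ->
  tform n u z = \sum_(w <- words n) Dw w u z *: mono w.
Proof.
elim: n u => [|n IH] u su.
  by rewrite big_seq1 /mono big_nil; apply/funext => y; rewrite /= [RHS]mulr1.
rewrite /= big_flatten/= big_map big_enum/=; apply: eq_bigr => i _.
rewrite IH; last exact: smooth_partial.
rewrite big_map mulr_sumr; apply: eq_bigr => w _.
rewrite -Dw_rcons mono_cons (Dw_perm su (_ : perm_eq _ (i :: w))) ?perm_rcons//.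
by apply/funext => y; exact: mulrCA.
Qed.

(** For [a] of degree [n], the moment of exponent [a] times a multinomial coefficient, the number of
    words with these multiplicities. *)
Definition moment_coeff T n a : R := \sum_(w <- words n | mult w == a) T (mono w).

(** The multinomial factor [k] is chosen before [T]: a linear relation between the coefficients of
    two functionals yields the same relation between their moments. *)
Lemma moment_coeffE w :
  exists2 k, (0 < k)%N &
    forall T : (Rd -> R) -> R, moment_coeff T (size w) (mult w) = T (mono w) *+ k.
Proof.
exists (count (fun w' => mult w' == mult w) (words (size w))).
  by rewrite -has_count; apply/hasP; exists w; rewrite ?mem_words.
move=> T; rewrite /moment_coeff (eq_bigr (fun=> T (mono w))).
  by rewrite big_const_seq iter_addr_0.
by move=> w'; rewrite mult_perm => pw; congr (T _); exact: perm_big.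
Qed.

(** Brings the leading coefficient into the shape of the genericity condition: as mixed derivatives
    commute, the words of length [n] are grouped by their multiindex. *)
Lemma hdiff_moment T n u z : tame_dual T -> csmooth u ->
  T (tform n u z) = hdiff n (moment_coeff T n) u z.
Proof.
move=> tT su; rewrite tform_words// tame_dual_sum//; last first.
  by move=> w; apply/tameZ/tame_mono.
rewrite (eq_bigr (fun w => mpartial (mult w) u z * T (mono w))); last first.
  by move=> w _; rewrite tame_dualZ ?Dw_mult//; exact: tame_mono.
pose s := undup [seq mult w | w <- words n].
have sE : [set a | mdegree a = n] = [set` s].
  apply/seteqP; split=> a /=; rewrite mem_undup.
    move=> <-; apply/mapP; exists (word a); last by rewrite mult_word.
    by rewrite mem_words size_word.
  by move=> /mapP[w]; rewrite mem_words => /eqP <- ->; rewrite mdegree_mult.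
rewrite /hdiff sE -fsbig_seq ?undup_uniq//.
rewrite [RHS](eq_bigr (fun a =>
    \sum_(w <- words n | mult w == a) mpartial (mult w) u z * T (mono w))).
  rewrite (exchange_big_dep predT)//=.
  rewrite [RHS](eq_big_seq (fun w => mpartial (mult w) u z * T (mono w)))//.
  move=> w wn; rewrite -big_filter (_ : [seq _ <- _ | _] = [:: mult w]) ?big_seq1//.
  have ms : mult w \in s by rewrite mem_undup map_f.
  have /(_ (undup_uniq _)) := @filter_pred1_uniq _ s (mult w).
  by move=> /(_ ms) <-; apply: eq_filter => a; rewrite /= eq_sym.
move=> a _; rewrite /moment_coeff mulr_suml; apply: eq_bigr => w /eqP ->.
exact: mulrC.
Qed.

End dual.

(** * Small-scale asymptotics of the transform *)

Section asymptotics.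
Context (R : realType) (d : nat).
Local Notation Rd := 'rV[R]_d.
Implicit Types (u v : Rd -> R) (x y z : Rd) (i j : 'I_d) (w : seq 'I_d)
  (T : (Rd -> R) -> R).

(** The minus sign of the convolution is put into [t]: by [conv_transform] the scale sigma
    corresponds to t = - 1 / sigma and z = x / sigma. *)
Definition transform T u (t : R) z : R := T (fun y => u (z + t *: y)).

(** Vanishing moments remove the Taylor terms of order below [n]. The remainder of order n + 1 has
    weight (1 + |y|)^(n+1) exp (e |y| / 2), and the other half of [e] absorbs the polynomial.
    Uniformity in [z] allows evaluation at zeros that move with [t]. *)
Lemma transform_asymptotics T u n (r : R) : tame_dual T -> tame u ->
  (forall w, (size w < n)%N -> T (mono w) = 0) ->
  exists2 B : R, 0 <= B & forall t z, `|t| <= 1 -> norm1 z <= r ->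
    `|transform T u t z - t ^+ n / n`!%:R * T (tform n u z)| <= B * `|t| ^+ n.+1.
Proof.
move=> tT tu Tn; have [_ [K [e [C [e0 e1 C0 TC]]]]] := tT.
have su := tame_smooth tu.
have e2 : 0 < e / 2 by rewrite divr_gt0.
have e21 : e / 2 <= 1 by lra.
have [M M0 MP] := tame_bd (n.+1 + K) tu e2.
pose L : R := (n.+2%:R / (e / 2)) ^+ n.+1.
have L0 : 0 <= L by rewrite exprn_ge0// divr_ge0// ltW.
exists (C * (M * expR (e / 2 * r) * L)).
  by rewrite !mulr_ge0// expR_ge0.
move=> t z t1 zr.
have -> : transform T u t z - t ^+ n / n`!%:R * T (tform n u z) = T (dtrem n.+1 u z t).
  rewrite /transform (taylor_expansion n.+1) tame_dualD//; last 2 first.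
  - by apply: tame_sum => k; apply/tameZ/tame_tform.
  - exact: tame_dtrem.
  rewrite tame_dual_sum//; last by move=> k; apply/tameZ/tame_tform.
  rewrite big_ord_recr big1 => [|k _]; last first.
    rewrite tame_dualZ//; last exact: tame_tform.
    rewrite tform_words// tame_dual_sum//; last by move=> w; apply/tameZ/tame_mono.
    rewrite big1_seq ?mulr0// => w /andP[_]; rewrite mem_words => /eqP wk.
    rewrite tame_dualZ; [|exact: tT|exact: tame_mono].
    by rewrite Tn ?mulr0// wk /=.
  rewrite tame_dualZ//; last exact: tame_tform.
  by rewrite /=; ring.
have := bd_dtrem z su M0 (ltW e2) t1 MP.
move=> H; rewrite -mulrA [_ * `|t| ^+ _]mulrC; apply: TC.
- exact: tame_dtrem.
- by rewrite !mulr_ge0// ?exprn_ge0// expR_ge0.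
apply: bd_le H _ => y.
have -> : e * norm1 y = e / 2 * norm1 y + e / 2 * norm1 y by rewrite -mulrDl -splitr.
rewrite expRD [leRHS](_ : _ = `|t| ^+ n.+1 * (M * expR (e / 2 * r)) *
  (L * expR (e / 2 * norm1 y) * expR (e / 2 * norm1 y))); last first.
  by ring.
apply: ler_pM.
- by rewrite !mulr_ge0 ?exprn_ge0 ?expR_ge0.
- by rewrite !mulr_ge0 ?exprn_ge0 ?expR_ge0 ?addr_ge0 ?norm1_ge0.
- by rewrite ler_wpM2l ?exprn_ge0// ler_wpM2l// ler_expR ler_wpM2l// ltW.
- by rewrite ler_wpM2r ?expR_ge0// poly_le_expR// norm1_ge0.
Qed.

(** By the continuity estimate it suffices to bound the difference of two translates and its
    derivatives; each is a Taylor remainder of order 1, at the cost of one more derivative of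
    [u]. *)
Lemma transform_lipschitz T u (t r : R) : tame_dual T -> tame u -> `|t| <= 1 -> 0 <= r ->
  exists2 B : R, 0 <= B & forall z z', norm1 z <= r -> norm1 z' <= r ->
    `|transform T u t z' - transform T u t z| <= B * norm1 (z' - z).
Proof.
move=> tT tu t1 r0; have [_ [K [e [C [e0 e1 C0 TC]]]]] := tT.
have su := tame_smooth tu.
have [M M0 MP] := tame_bd K.+1 tu e0.
exists (C * (M * expR (e * (r + (r + r))))); first by rewrite !mulr_ge0// expR_ge0.
move=> z z' zr zr'; have Nv := norm1_ge0 (z' - z).
have -> : transform T u t z' - transform T u t z =
    T ((fun y => u (z' + t *: y)) - (fun y => u (z + t *: y))).
  by rewrite tame_dualB//; exact: tame_affine.
rewrite -mulrA; apply: TC.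
- by apply: tameB; exact: tame_affine.
- by rewrite !mulr_ge0// expR_ge0.
move=> w wK y; rewrite DwD; [|exact: smooth_affine|exact/smoothN/smooth_affine].
rewrite -scaleN1r DwZ; last exact: smooth_affine.
rewrite scaleN1r !Dw_affine// -scalerBr.
rewrite -[leLHS]/(`|t ^+ size w * (Dw w u (z' + t *: y) - Dw w u (z + t *: y))|).
rewrite normrM normrX (@le_trans _ _ `|Dw w u (z' + t *: y) - Dw w u (z + t *: y)|)//.
  by rewrite ler_piMl// exprn_ile1.
suff : `|trem 1 (Dw w u) (z + t *: y) (z' - z)| <=
    M * norm1 (z' - z) ^+ 1 / 1`!%:R * expR (e * (norm1 (z + t *: y) + norm1 (z' - z))).
  have -> : trem 1 (Dw w u) (z + t *: y) (z' - z) = Dw w u (z' + t *: y) - Dw w u (z + t *: y).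
    rewrite /trem /taylor big_ord1 fact0 invr1 scale1r /=.
    rewrite -[LHS]/(Dw w u (z + t *: y + 1 *: (z' - z)) - Dw w u (z + t *: y)).
    by rewrite scale1r (_ : _ + (z' - z) = z' + t *: y)// addrC addrA subrK.
  move=> /le_trans; apply; rewrite factS fact0 divr1 expr1 -!mulrA ler_wpM2l//.
  rewrite mulrCA ler_wpM2l// -expRD -mulrDr ler_expR ler_wpM2l ?(ltW e0)//.
  have := norm1D z (t *: y); have := norm1D z' (- z).
  rewrite norm1N norm1Z.
  have : `|t| * norm1 y <= norm1 y by rewrite ler_piMl ?norm1_ge0.
  lra.
apply: trem_bound => //; [exact: smooth_Dw|exact: ltW|].
by move=> w' x w'1; rewrite -Dw_cat MP// size_cat w'1 add1n ltnS.
Qed.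

Lemma transform_continuous T u (t : R) : tame_dual T -> tame u -> `|t| <= 1 ->
  continuous (transform T u t).
Proof.
move=> tT tu t1 z; have r0 : 0 <= norm1 z + d%:R.
  by rewrite addr_ge0 ?norm1_ge0.
have [B B0 BP] := transform_lipschitz tT tu t1 r0.
have Fz : Filter (nbhs z) by exact: nbhs_filter.
apply/(@cvgrPdist_lt _ _ _ _ Fz) => e e0.
have q0 : 0 < e / (B * d%:R + 1) by rewrite divr_gt0// ltr_wpDl// mulr_ge0.
apply/nbhs_ballP; exists (Num.min 1 (e / (B * d%:R + 1))) => /=.
  by rewrite lt_min ltr01.
move=> x; rewrite -ball_normE/= lt_min => /andP[x1 xe].
have N1 : norm1 (z - x) <= d%:R * `|z - x| by exact: norm1_norm.
have xr : norm1 x <= norm1 z + d%:R.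
  have -> : x = z + - (z - x) by rewrite opprB addrC subrK.
  rewrite (le_trans (norm1D _ _))// lerD2l norm1N (le_trans N1)//.
  by rewrite ler_piMr// ltW.
have zr : norm1 z <= norm1 z + d%:R by rewrite lerDl.
apply: (le_lt_trans (BP x z xr zr)).
apply: (@le_lt_trans _ _ (B * d%:R * `|z - x|)); first by rewrite -mulrA ler_wpM2l.
move: xe; rewrite ltr_pdivlMr ?ltr_wpDl ?mulr_ge0// => /(le_lt_trans _); apply.
by rewrite mulrC ler_wpM2l// lerDl.
Qed.

Lemma smooth_moment T n u : tame_dual T -> csmooth u ->
  csmooth (fun z => T (tform n u z)).
Proof.
move=> tT su.
have -> : (fun z => T (tform n u z)) = \sum_(w <- words d n) T (mono w) *: Dw w u.
  apply/funext => z; rewrite tform_words// tame_dual_sum//; last first.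
    by move=> w; apply/tameZ/tame_mono.
  rewrite fct_sumE; apply: eq_bigr => w _.
  by rewrite tame_dualZ//; [exact: mulrC|exact: tame_mono].
by apply: smooth_sum => w; apply/smoothZ/smooth_Dw.
Qed.

(** After multiplication by t^n the main term is t^(2n) A / n!, whose sign does not depend on that
    of [t], negative in the applications. *)
Lemma approx_pos (F A B t : R) n : t != 0 ->
  `|F - t ^+ n / n`!%:R * A| <= B * `|t| ^+ n.+1 -> B * `|t| < A / n`!%:R ->
  0 < t ^+ n * F.
Proof.
move=> t0 FA BA.
have tn : 0 < `|t| ^+ n by rewrite exprn_gt0// normr_gt0.
have : `|t ^+ n * F - `|t| ^+ n * `|t| ^+ n * (A / n`!%:R)| <= `|t| ^+ n * `|t| ^+ n * (B * `|t|).
  have -> : t ^+ n * F - `|t| ^+ n * `|t| ^+ n * (A / n`!%:R) =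
      t ^+ n * (F - t ^+ n / n`!%:R * A).
    rewrite -exprMn -expr2 real_normK ?num_real// expr2 exprMn; ring.
  rewrite normrM normrX (_ : _ * _ * _ = `|t| ^+ n * (B * `|t| ^+ n.+1)); last first.
    by rewrite exprS; ring.
  by rewrite ler_wpM2l// ltW.
rewrite ler_norml => /andP[H _]; move: H.
have : `|t| ^+ n * `|t| ^+ n * (B * `|t|) < `|t| ^+ n * `|t| ^+ n * (A / n`!%:R).
  by rewrite ltr_pM2l// mulr_gt0.
lra.
Qed.

Lemma pow2_small (b : R) : 0 < b -> exists k : nat, (2 ^+ k)^-1 < b.
Proof.
move=> b0; exists (Num.truncn b^-1).+1.
rewrite -[ltRHS]invrK ltf_pV2 ?posrE ?invr_gt0 ?exprn_gt0//.
rewrite (lt_trans (truncnS_gt _))// -natrX ltr_nat.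
exact: ltn_expl.
Qed.

(* Near a regular zero of its leading term, the rescaled transform of T1 changes
   sign at all small scales; the zeros this produces are zeros of the transform of T2. *)
Lemma regular_zeros_limit T1 T2 u n m : tame_dual T1 -> tame_dual T2 -> tame u ->
  (forall w, (size w < n)%N -> T1 (mono w) = 0) ->
  (forall w, (size w < m)%N -> T2 (mono w) = 0) ->
  (forall (k : nat) z, transform T1 u (- (2 ^+ k)^-1) z = 0 ->
               transform T2 u (- (2 ^+ k)^-1) z = 0) ->
  regular_zeros (fun z => T1 (tform n u z)) `<=` zeros (fun z => T2 (tform m u z)).
Proof.
move=> tT1 tT2 tu T1n T2m T12 z0 z0reg; rewrite /zeros/=; apply/eqP/negPn/negP => A20.
pose a2 := `|T2 (tform m u z0)|; have a20 : 0 < a2 by rewrite normr_gt0.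
have := smooth_continuous (smooth_moment m tT2 (tame_smooth tu)).
(* Around [z0] the leading coefficient of [T2] stays above a2 / 2 in absolute value; the regular
   zero supplies points of both signs within this ball. *)
have a22 : 0 < a2 / 2 by rewrite divr_gt0.
move=> /(_ z0) /cvgr_dist_lt /(_ _ a22) /nbhs_ballP[r /= r0 rP].
have [[yp yp0 yp1] [yn yn0 yn1]] := z0reg _ (nbhsx_ballx z0 r r0).
have seg (s : R) : 0 <= s <= 1 -> ball z0 r (yn + s *: (yp - yn)).
  move=> /andP[s0 s1]; move: yp0 yn0; rewrite -ball_normE/= => yp0 yn0.
  have -> : z0 - (yn + s *: (yp - yn)) = (1 - s) *: (z0 - yn) + s *: (z0 - yp).
    by apply/rowP => j; rewrite !mxE; ring.
  rewrite (le_lt_trans (ler_normD _ _))// !normrZ !ger0_norm ?subr_ge0//.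
  have [->|s00] := eqVneq s 0; first by rewrite subr0 mul1r mul0r addr0.
  have : s * `|z0 - yp| < s * r by rewrite ltr_pM2l// lt0r s00.
  have : (1 - s) * `|z0 - yn| <= (1 - s) * r by rewrite ler_wpM2l ?subr_ge0// ltW.
  lra.
have bz z : ball z0 r z -> norm1 z <= norm1 z0 + d%:R * r.
  rewrite -ball_normE/= => zr.
  have -> : z = z0 + - (z0 - z) by rewrite opprB addrC subrK.
  rewrite (le_trans (norm1D _ _))// lerD2l norm1N (le_trans (norm1_norm _))//.
  by rewrite ler_wpM2l// ltW.
have [B1 B10 B1P] := transform_asymptotics (norm1 z0 + d%:R * r) tT1 tu T1n.
have [B2 B20 B2P] := transform_asymptotics (norm1 z0 + d%:R * r) tT2 tu T2m.
(* Three thresholds for the error: [q1] and [q2] preserve the signs of the leading term of [T1] at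
   [yp] and [yn], [q3] lies below that of [T2] on the ball, up to the power of [t]. *)
pose q1 := T1 (tform n u yp) / n`!%:R; pose q2 := - T1 (tform n u yn) / n`!%:R.
pose q3 := a2 / 2 / m`!%:R.
have f0 k : 0 < k`!%:R :> R by rewrite ltr0n fact_gt0.
have q10 : 0 < q1 by rewrite divr_gt0.
have q20 : 0 < q2 by rewrite divr_gt0// oppr_gt0.
have q30 : 0 < q3 by rewrite divr_gt0.
pose q := Num.min q1 (Num.min q2 q3).
have q0 : 0 < q by rewrite !lt_min q10 q20.
have B0 : 0 < B1 + B2 + 1 by rewrite ltr_wpDl// addr_ge0.
have [i iq] := pow2_small (divr_gt0 q0 B0).
pose t : R := - (2 ^+ i)^-1.
have p0 : 0 < (2 ^+ i)^-1 :> R by rewrite invr_gt0 exprn_gt0.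
have t0 : t != 0 by rewrite oppr_eq0 lt0r_neq0.
have tE : `|t| = (2 ^+ i)^-1 by rewrite normrN gtr0_norm.
have t1 : `|t| <= 1 by rewrite tE invf_le1 ?exprn_gt0// exprn_ege1// ler1n.
have Bt B q' : 0 <= B -> B <= B1 + B2 -> q <= q' -> B * `|t| < q'.
  move=> BB0 BB qq; apply: (lt_le_trans _ qq).
  apply: (@le_lt_trans _ _ ((B1 + B2 + 1) * `|t|)).
    by rewrite ler_wpM2r// (le_trans BB)// lerDl.
  by rewrite tE mulrC -ltr_pdivlMr.
have Fp : 0 < t ^+ n * transform T1 u t yp.
  apply: approx_pos t0 (B1P t yp t1 (bz _ yp0)) _.
  by apply: Bt; rewrite ?lerDl// /q ge_min lexx.
have Fn : 0 < t ^+ n * (- transform T1 u t yn).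
  apply: (@approx_pos _ (- T1 (tform n u yn)) B1 t n t0).
    by rewrite mulrN -opprD normrN; exact: B1P t yn t1 (bz _ yn0).
  by apply: Bt; rewrite ?lerDl// /q !ge_min lexx orbT.
pose h (s : R) := t ^+ n * transform T1 u t (yn + s *: (yp - yn)).
have ch : continuous h.
  move=> s; apply: (@continuousM R R (cst (t ^+ n))
    (fun s => transform T1 u t (yn + s *: (yp - yn)))); first exact: cst_continuous.
  apply: (@continuous_comp _ _ _ (fun s : R => yn + s *: (yp - yn)) (transform T1 u t)).
    apply: (@continuousD R Rd R (cst yn) (fun s : R => s *: (yp - yn))).
      exact: cst_continuous.
    by apply: continuousZr_tmp; exact: cvg_id.
  exact: transform_continuous.
have h0 : h 0 < 0 by rewrite /h scale0r addr0 -oppr_gt0 -mulrN.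
have h1 : 0 < h 1 by rewrite /h scale1r addrC subrK.
have [|s s01 hs] := @IVT R h 0 1 0 ler01 (continuous_subspaceT ch).
  by rewrite ge_min le_max (ltW h0) (ltW h1) orbT.
move: s01; rewrite in_itv/= => /seg zs.
set z := yn + s *: (yp - yn) in zs.
have /T12 F2 : transform T1 u t z = 0.
  by move: hs => /eqP; rewrite /h mulf_eq0 expf_eq0 (negPf t0) andbF/= => /eqP.
(* The transform of [T2] vanishes at [z], so its leading term is bounded by the error alone; this
   contradicts the lower bound a2 / 2 on the ball. *)
have := B2P t z t1 (bz _ zs); rewrite F2 sub0r normrN => H.
have Ha : `|T2 (tform m u z)| / m`!%:R <= B2 * `|t|.
  have tm : 0 < `|t| ^+ m by rewrite exprn_gt0// normr_gt0.
  rewrite -(ler_pM2l tm); move: H; rewrite !normrM normfV normrX [`|m`!%:R|]ger0_norm//.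
  rewrite exprS => H'; rewrite [leLHS](_ : _ = `|t| ^+ m / m`!%:R * `|T2 (tform m u z)|); last ring.
  by rewrite [leRHS](_ : _ = B2 * (`|t| * `|t| ^+ m)); last ring.
have Hb : B2 * `|t| < q3 by apply: Bt; rewrite ?lerDr// /q !ge_min lexx !orbT.
have := le_lt_trans Ha Hb; rewrite /q3 ltr_pM2r ?invr_gt0//.
have := rP z zs; rewrite -/a2 => H1 H2.
have := ler_distD (T2 (tform m u z)) (T2 (tform m u z0)) 0; rewrite !subr0 -/a2.
lra.
Qed.

End asymptotics.

(** * Cutoff functions *)

Section flat.
Context (R : realType).
Implicit Types (p : {poly R}) (x : R).

(* These functions are stable under derivation, which makes them smooth at 0. *)
Definition flat p x : R := if 0 < x then p.[x^-1] * expR (- x^-1) else 0.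

Lemma flat_bounded p : exists C : R, forall x, `|flat p x| <= C.
Proof.
exists (\sum_(i < size p) `|p`_i| * i`!%:R) => x; rewrite /flat.
case: ifPn => [x0|_]; last first.
  by rewrite normr0 sumr_ge0// => i _; rewrite mulr_ge0.
rewrite horner_coef mulr_suml (le_trans (ler_norm_sum _ _ _))//.
apply: ler_sum => i _; rewrite -mulrA normrM ler_wpM2l//.
have x1 : 0 <= x^-1 by rewrite invr_ge0 ltW.
rewrite ger0_norm ?mulr_ge0 ?exprn_ge0 ?expR_ge0// expRN ler_pdivrMr ?expR_gt0//.
have := exprn_le_expR i x1; rewrite ler_pdivrMr; last by rewrite ltr0n fact_gt0.
by rewrite mulrC.
Qed.

(** Off 0 this is the chain rule for 1/x. At 0 the quotient [h^-1 * flat p h] equals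
    [h * flat ('X^2 * p) h], a bounded function times [h]. *)
Lemma is_derive_flat p x : is_derive x 1 (flat p) (flat ('X^2 * (p - p^`())) x).
Proof.
have [x0|x0|<-] := ltgtP 0 x.
- pose G (u : R) : R := p.[u] * expR (- u).
  have GE (u : R) : is_derive u 1 G (p^`().[u] * expR (- u) - p.[u] * expR (- u)).
    have hp : is_derive u 1 (horner p) (p^`().[u]).
      apply: DeriveDef; first exact: derivable_horner.
      by rewrite derivE derive1E.
    have he : is_derive u 1 (fun u : R => expR (- u)) (- expR (- u)).
      have -> : - expR (- u) = expR (- u) * (- 1) by rewrite mulrN1.
      apply: (@is_derive1_comp R expR (fun u => - u)).
    have := @is_deriveM R _ _ _ u 1 _ _ hp he.
    congr is_derive; rewrite -[LHS]/(p.[u] * - expR (- u) + expR (- u) * p^`().[u]).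
    by ring.
  have iE : is_derive x 1 (fun y : R => y^-1) (- x ^- 2).
    have -> : - x ^- 2 = - x ^- 2 *: 1 by rewrite [RHS]mulr1.
    by apply: is_deriveV; rewrite gt_eqF.
  have := is_derive1_comp (GE x^-1) iE.
  have -> : (p^`().[x^-1] * expR (- x^-1) - p.[x^-1] * expR (- x^-1)) * - x ^- 2 =
      flat ('X^2 * (p - p^`())) x.
    by rewrite /flat x0 !hornerE -exprVn; ring.
  apply: near_eq_is_derive; near=> y; rewrite /flat /G /= ifT//.
  by near: y; exact: lt_nbhsr.
- have -> : flat ('X^2 * (p - p^`())) x = 0 by rewrite /flat ltNge (ltW x0).
  apply: (@near_eq_is_derive _ _ _ (cst 0)).
  near=> y; rewrite /flat ifF//; apply/negbTE; rewrite -leNgt ltW//.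
  by near: y; exact: lt_nbhsl.
- have -> : flat ('X^2 * (p - p^`())) 0 = 0 by rewrite /flat ltxx.
  have [C CP] := flat_bounded ('X^2 * p).
  have C0 : 0 <= C by apply: le_trans (CP 0).
  apply/(@is_derive_epsP R R) => e e0; exists (e / (C + 1)).
    by rewrite divr_gt0// ltr_wpDl.
  move=> h h0 he; rewrite add0r normrN add0r [h%:A]mulr1.
  rewrite /flat ltxx subr0; have [hp|hn] := ltP 0 h; last by rewrite mulr0 normr0.
  have -> : h^-1 * (p.[h^-1] * expR (- h^-1)) = h * flat ('X^2 * p) h.
    by rewrite /flat hp hornerM hornerXn; move: (expR _) (p.[_]) => a b; field; exact: lt0r_neq0.
  rewrite normrM; apply: (@le_lt_trans _ _ (`|h| * (C + 1))).
    by rewrite ler_wpM2l// (le_trans (CP h))// lerDl.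
  by rewrite -ltr_pdivlMr// ltr_wpDl.
Unshelve. all: by end_near.
Qed.

Lemma flatZ p (c x : R) : flat (c *: p) x = c * flat p x.
Proof. by rewrite /flat; case: ifP; rewrite ?mulr0// hornerZ mulrA. Qed.

Lemma continuous_flat p : continuous (flat p).
Proof.
move=> x; apply: differentiable_continuous; apply/derivable1_diffP.
by have [] := is_derive_flat p x.
Qed.

End flat.

(** * A smooth bump and its dilates *)

Section cutoff.
Context (R : realType) (d : nat).
Local Notation Rd := 'rV[R]_d.
Implicit Types (u v : Rd -> R) (x y z : Rd) (i j : 'I_d) (w : seq 'I_d)
  (T : (Rd -> R) -> R).

(** Plain boundedness, without exponential weight, so that dilation by |t| <= 1 keeps bounds
    independent of [t]. *)
Variant bder u : Prop := Bder of csmooth u & forall K, exists2 M : R, 0 <= M & bd K u (fun=> M).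

Lemma bder_words u : csmooth u -> (forall w, exists M, forall y, `|Dw w u y| <= M) -> bder u.
Proof.
move=> su uM; split=> // K.
have [||M M0 MP] := @bd_words R d u (fun=> 1) K => //.
  by move=> w; have [M MP] := uM w; exists M => y; rewrite mulr1.
by exists M => // w wK y; rewrite -[M]mulr1 MP.
Qed.

Lemma bder_smooth u : bder u -> csmooth u. Proof. by case. Qed.

Lemma bder_tame u : bder u -> tame u.
Proof.
move=> [su uM]; split=> // K e e0; have [M M0 MP] := uM K; exists M => //.
apply: bd_le MP _ => y; rewrite ler_peMr//.
by rewrite -expR0 ler_expR mulr_ge0 ?(ltW e0) ?norm1_ge0.
Qed.

Lemma bderM u v : bder u -> bder v -> bder (u * v).
Proof.
move=> [su uM] [sv vM]; split=> [|K]; first exact: smoothM.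
have [M M0 MP] := uM K; have [L L0 LP] := vM K.
exists (2 ^+ K * (M * L)); first by rewrite !mulr_ge0// exprn_ge0.
exact: (bdM su sv MP LP).
Qed.

Lemma bder_cst (k : R) : bder (cst k).
Proof.
apply: bder_words; first exact: smooth_cst.
by move=> w; exists `|k| => y; rewrite Dw_cst; case: w => //=; rewrite normr0.
Qed.

Lemma bder_prod (I : Type) (r : seq I) (P : pred I) (F : I -> Rd -> R) :
  (forall k, bder (F k)) -> bder (\prod_(k <- r | P k) F k).
Proof.
move=> sF; elim/big_ind : _ => //; [exact: (bder_cst 1)|exact: bderM].
Qed.

Lemma is_derive_coord_comp (g : R -> R) (dg a c : R) i j x :
  is_derive (a + c * x ord0 i) (1 : R) g dg ->
  is_derive x (delta_mx ord0 j) (fun y : Rd => g (a + c * y ord0 i)) (c * (i == j)%:R * dg).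
Proof.
move=> H; have {}H := is_derive_scale (c * (i == j)%:R) H.
apply/is_derive_epsP => e e0.
have [r r0 rP] := (is_derive_epsP _ _ _ _).1 H e e0; exists r => // h h0 hr.
have -> : a + c * (x + h *: delta_mx ord0 j) ord0 i =
    a + c * x ord0 i + h *: ((c * (i == j)%:R) *: (1 : R)).
  rewrite !mxE eqxx/= -[h *: (_ *: _)]/(h * (c * (i == j)%:R * 1)); ring.
exact: rP.
Qed.

Lemma bder_flat (p : {poly R}) (c : R) i : bder (fun y : Rd => flat p (1 + c * y ord0 i)).
Proof.
pose C := [set u : Rd -> R | exists p : {poly R}, u = fun y => flat p (1 + c * y ord0 i)].
have Cd q j x := @is_derive_coord_comp (flat q) _ 1 c i j x (is_derive_flat q (1 + c * x ord0 i)).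
have Cp q j : partial j (fun y : Rd => flat q (1 + c * y ord0 i)) =
    fun y => flat ((c * (i == j)%:R) *: ('X^2 * (q - q^`()))) (1 + c * y ord0 i).
  by apply/funext => x; have [_] := Cd q j x; rewrite flatZ.
have CC u : C u -> [/\ continuous u, forall i x, derivable u x (delta_mx ord0 i)
                     & forall i, C (partial i u)].
  move=> [q ->]; split=> [x|j x|j].
  - apply: (@continuous_comp _ _ _ (fun y : Rd => 1 + c * y ord0 i) (flat q)).
      apply: (@continuousD R R Rd (cst 1) (fun y : Rd => c * y ord0 i)).
        exact: cst_continuous.
      apply: (@continuousM R Rd (cst c) (fun y : Rd => y ord0 i)).
        exact: cst_continuous.
      exact: coord_continuous.
    exact: continuous_flat.
  - by have [] := Cd q j x.
  - by exists ((c * (i == j)%:R) *: ('X^2 * (q - q^`()))).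
apply: bder_words; first by apply: (smooth_class CC); exists p.
move=> w; have : C (Dw w (fun y : Rd => flat p (1 + c * y ord0 i))).
  by elim: w => [|j w IH]; [exists p|rewrite Dw_cons; have [_ _] := CC _ IH].
by move=> [q ->]; have [M MP] := flat_bounded q; exists M.
Qed.

(** Supported in |y_i| <= 1; [expR 2] normalizes it at 0, where each flat factor is exp (-1). *)
Definition bump_factor i : Rd -> R := fun y =>
  expR 2 * (flat 1 (1 + 1 * y ord0 i) * flat 1 (1 + (-1) * y ord0 i)).

Definition bumpf : Rd -> R := \prod_i bump_factor i.

Lemma bder_bumpf : bder bumpf.
Proof.
apply: bder_prod => i; apply: (@bderM (cst (expR 2))); first exact: bder_cst.
by apply: (@bderM (fun y => flat 1 (1 + 1 * y ord0 i))); exact: bder_flat.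
Qed.

Lemma bumpf0 : bumpf 0 = 1.
Proof.
rewrite /bumpf fct_prodE big1// => i _.
rewrite /bump_factor !mxE !mulr0 !addr0 /flat ltr01 hornerC mul1r invr1.
by rewrite -!expRD (_ : 2 + _ = 0) ?expR0//; ring.
Qed.

Lemma bumpf_support y : bumpf y != 0 -> forall i, `|y ord0 i| <= 1.
Proof.
rewrite /bumpf fct_prodE => /prodf_neq0 H i; have := H i isT.
rewrite /bump_factor /flat; case: ifPn => [h1|_]; last by rewrite mul0r mulr0 eqxx.
case: ifPn => [h2 _|_]; last by rewrite !mulr0 eqxx.
by rewrite ler_norml; apply/andP; split; lra.
Qed.

Definition cutoff (t : R) : Rd -> R := fun y => bumpf (0 + t *: y).

Lemma bder_cutoff t : bder (cutoff t).
Proof.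
have [sb bM] := bder_bumpf; split=> [|K]; first exact: smooth_affine.
have [M M0 MP] := bM K; exists ((`|t| + 1) ^+ K * M).
  by rewrite mulr_ge0// exprn_ge0// addr_ge0.
move=> w wK y; rewrite Dw_affine//.
rewrite -[leLHS]/(`|t ^+ size w * Dw w bumpf (0 + t *: y)|) normrM normrX.
apply: ler_pM => //; last exact: MP.
rewrite (@le_trans _ _ ((`|t| + 1) ^+ size w))//.
  by apply: lerXn2r; rewrite ?nnegrE ?addr_ge0// lerDl.
by rewrite ler_weXn2l// lerDr.
Qed.

(** As [bumpf 0 = 1], the difference is a Taylor remainder of order 1 at scale [t]; this gives the
    factor |t| for the derivatives too. *)
Lemma bd_cutoff K : exists2 M : R, 0 <= M & forall t, `|t| <= 1 ->
  bd K (cutoff t - cst 1) (fun y => `|t| * M * (1 + norm1 y)).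
Proof.
have [sb bM] := bder_bumpf; have [M M0 MP] := bM (1 + K)%N; exists M => // t t1.
have -> : cutoff t - cst 1 = dtrem 1 bumpf 0 t.
  apply/funext => y; rewrite /dtrem /trem /taylor big_ord1 fact0 invr1 scale1r/=.
  rewrite -[RHS]/(bumpf (0 + 1 *: (0 + t *: y)) - bumpf 0) bumpf0.
  by rewrite scale1r add0r.
have MP' : bd (1 + K) bumpf (fun y => M * expR (0 * norm1 y)).
  by apply: bd_le MP _ => y; rewrite mul0r expR0 mulr1.
apply: bd_le (bd_dtrem 0 sb M0 (lexx 0) t1 MP') _ => y.
by rewrite !mul0r expR0 !mulr1 !expr1.
Qed.

(** The error is [T] of (cutoff - 1) u, of size 1 / (n+1) with weight (1 + |y|) exp (e |y| / 2),
    which exp (e |y|) dominates. *)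
Lemma cutoff_cvg T u : tame_dual T -> tame u ->
  T (cutoff (n.+1%:R^-1) * u) @[n --> \oo] --> T u.
Proof.
move=> tT tu; have [_ [K [e [C [e0 e1 C0 TC]]]]] := tT.
have e2 : 0 < e / 2 by rewrite divr_gt0.
have [M M0 MP] := tame_bd K tu e2; have [L L0 LP] := bd_cutoff K.
pose A : R := 2%:R / (e / 2).
have A0 : 0 <= A by rewrite divr_ge0// ltW.
have AP y : 1 + norm1 y <= A * expR (e / 2 * norm1 y).
  have := @poly_le_expR R 1 (e / 2) (norm1 y) e2 _ (norm1_ge0 y).
  by rewrite !expr1 -/A; apply; lra.
clearbody A.
have key n : `|T u - T (cutoff (n.+1%:R^-1) * u)| <= C * (2 ^+ K * (L * A * M)) * n.+1%:R^-1.
  set t : R := n.+1%:R^-1; have t0 : 0 <= t by rewrite invr_ge0.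
  have t1 : `|t| <= 1 by rewrite ger0_norm// invf_le1 ?ler1n.
  have tc : tame (cutoff t) by exact/bder_tame/bder_cutoff.
  have tc1 : tame (cutoff t - cst 1) by apply: tameB => //; exact: tame_cst.
  rewrite distrC -tame_dualB//; last exact: tameM.
  have -> : cutoff t * u - u = (cutoff t - cst 1) * u.
    by apply/funext => y; rewrite -[RHS]/((cutoff t y - 1) * u y) mulrBl mul1r.
  rewrite -mulrA; apply: TC; first exact: tameM.
    by rewrite !mulr_ge0// exprn_ge0.
  apply: bd_le (bdM (tame_smooth tc1) (tame_smooth tu) (LP t t1) MP) _ => y.
  rewrite -[leLHS]/(2 ^+ K * ((`|t| * L * (1 + norm1 y)) * (M * expR (e / 2 * norm1 y)))).
  rewrite ger0_norm//.
  have -> : e * norm1 y = e / 2 * norm1 y + e / 2 * norm1 y by rewrite -mulrDl -splitr.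
  rewrite expRD.
  rewrite [leLHS](_ : _ = 2 ^+ K * (L * M) * t * expR (e / 2 * norm1 y) * (1 + norm1 y)); last ring.
  rewrite [leRHS](_ : _ = 2 ^+ K * (L * M) * t * expR (e / 2 * norm1 y) *
    (A * expR (e / 2 * norm1 y))); last ring.
  by rewrite ler_wpM2l// !mulr_ge0 ?expR_ge0 ?exprn_ge0.
apply/cvgrPdist_le => eps eps0.
set B := C * _ in key; have B0 : 0 <= B by rewrite !mulr_ge0// exprn_ge0.
have : B * n.+1%:R^-1 @[n --> \oo] --> 0.
  rewrite -(mulr0 B); apply: cvgM; first exact: cvg_cst.
  exact: cvg_harmonic.
move=> /cvgrPdist_le /(_ _ eps0); apply: filterS => n.
rewrite sub0r normrN ger0_norm ?mulr_ge0 ?invr_ge0//; exact: le_trans.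
Qed.

Lemma test_function_cutoff (t : R) u : 0 < t -> csmooth u -> test_function (cutoff t * u).
Proof.
move=> t0 su; split.
  by apply: csmooth_smooth; apply: smoothM => //; exact/bder_smooth/bder_cutoff.
pose B : set Rd := [set x | forall i, `[- t^-1, t^-1]%classic (x ord0 i)].
have cB : compact B by exact: box_compact.
apply: (subclosed_compact _ cB); first exact: closed_closure.
have clB : closed B by apply: compact_closed => //; exact: norm_hausdorff.
rewrite [B](closure_id _).1//; apply: closure_subset.
move=> x /= ux i; have : bumpf (0 + t *: x) != 0.
  by apply: contra_neq ux => ux; rewrite -[LHS]/(bumpf (0 + t *: x) * u x) ux mul0r.
move=> /bumpf_support /(_ i); rewrite !mxE add0r normrM gtr0_norm// => H.
by rewrite /= in_itv/= -ler_norml -[leRHS]mul1r ler_pdivlMr// mulrC.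
Qed.

End cutoff.

(** * Integration against an integrable function *)

Import HBNNSimple.

Section integration.
Context (R : realType) (dd : measure_display) (X : measurableType dd)
  (mu : {measure set X -> \bar R}).
Implicit Types (f g : X -> R).

(** Holds for arbitrary [g]: integrals of nonnegative functions are suprema over simple functions,
    and those below the positive or negative part of [g] vanish off [N]. *)
Lemma integral_null (N : set X) (g : X -> \bar R) : measurable N -> mu N = 0 ->
  (forall x, ~ N x -> g x = 0%E) -> (\int[mu]_x g x = 0)%E.
Proof.
move=> mN N0 gN.
have key (h : X -> \bar R) : (forall x, 0 <= h x)%E -> (forall x, ~ N x -> h x = 0%E) ->
    (\int[mu]_x h x = 0)%E.
  move=> h0 hN; apply/eqP; rewrite eq_le; apply/andP; split; last exact: integral_ge0.
  rewrite ge0_integralTE//; apply: ub_ereal_sup => _ [s sh <-].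
  have -> : sintegral mu s = (\int[mu]_x (s x)%:E)%E.
    by rewrite integral_nnsfun// patch_setT.
  rewrite (ae_eq_integral (cst 0%E))//; first by rewrite integral0.
    exact/measurable_EFinP.
  exists N; split => // x /= H; apply: contrapT => Nx; apply: H => _.
  have := sh x; rewrite (hN _ Nx) lee_fin => s0; congr EFin.
  by apply/le_anti; rewrite s0/=.
have gp : (\int[mu]_x (g^\+ x) = 0)%E.
  by apply: key => x; [exact: funepos_ge0|move=> /gN E; rewrite funeposE E maxxx].
have gm : (\int[mu]_x (g^\- x) = 0)%E.
  by apply: key => x; [exact: funeneg_ge0|move=> /gN E; rewrite funenegE E oppe0 maxxx].
by rewrite integralE gp gm subee.
Qed.

Lemma Rintegral_ae0 f g : measurable_fun setT f -> {ae mu, forall x, f x = 0} ->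
  \int[mu]_x (f x * g x) = 0.
Proof.
move=> mf f0; pose N := [set x | f x != 0].
have mN : measurable N.
  rewrite (_ : N = f @^-1` (~` [set 0])).
    rewrite -[X in measurable X]setTI; apply: mf => //; exact: measurableC.
  by apply/seteqP; split => x /= /eqP.
rewrite /Rintegral (integral_null mN)//; last first.
  by move=> x /negP; rewrite negbK => /eqP ->; rewrite mul0r.
apply/(@negligibleP _ _ _ mu N mN); move: f0; apply: negligibleS => x /= /eqP fx0 H; exact: fx0.
Qed.

Lemma cvg_Rintegral_bounded f (phi : nat -> X -> R) (psi : X -> R) (M : R) :
  mu.-integrable setT (EFin \o f) ->
  (forall n, measurable_fun setT (phi n)) -> (forall n x, `|phi n x| <= M) ->
  (forall x, phi n x @[n --> \oo] --> psi x) ->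
  \int[mu]_x (f x * phi n x) @[n --> \oo] --> \int[mu]_x (f x * psi x).
Proof.
move=> intf mphi phiM phipsi.
have mf : measurable_fun setT f by apply/measurable_EFinP; exact: measurable_int intf.
have M0 (x : X) : 0 <= M by rewrite (le_trans _ (phiM 0%N x)).
have mpsi : measurable_fun setT psi.
  by apply: (@measurable_fun_cvg _ _ _ _ phi) => // x _; exact: phipsi.
have intM : mu.-integrable setT (fun x => (M * `|f x|)%:E).
  rewrite (_ : (fun _ => _) = (fun x => M%:E * (abse \o (EFin \o f)) x)%E)//.
  by apply: integrableZl => //; exact: integrable_abse.
have fc : forall x, (f x * phi n x)%:E @[n --> \oo] --> (f x * psi x)%:E.
  move=> x; apply: cvg_EFin; first by apply: nearW.
  by apply: cvgM; [exact: cvg_cst|exact: phipsi].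
have [|||||? _ H] := @dominated_convergence _ X R mu setT measurableT
  (fun n x => (f x * phi n x)%:E) (fun x => (f x * psi x)%:E) (fun x => (M * `|f x|)%:E).
- by move=> n; apply/measurable_EFinP; exact: measurable_funM.
- by apply/measurable_EFinP; exact: measurable_funM.
- by apply: aeW => x _; exact: fc.
- exact: intM.
- by apply: aeW => x n _; rewrite lee_fin normrM mulrC ler_wpM2r.
apply: fine_cvg; rewrite fineK//; exact: integrable_fin_num.
Qed.

End integration.

(** * Integrable functions determined by their integrals over orthants *)

Section orthants.
Context (R : realType) (d : nat).
Local Notation Rd := 'rV[R]_d.
Local Notation mu := (lebesgue_rV R d).

Definition orthant (c : Rd) : set Rd := [set y | forall i, c ord0 i < y ord0 i].

Lemma orthantE c y : (\1_(orthant c) y : R) = \prod_i (c ord0 i < y ord0 i)%R%:R.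
Proof.
rewrite indicE; have [yc|yc] := boolP (y \in orthant c).
  by rewrite big1// => i _; move: yc; rewrite inE => ->.
have [i ci] : exists i, ~~ (c ord0 i < y ord0 i)%R.
  apply: contrapT => H; move: yc; rewrite notin_setE; apply => i.
  by apply: contrapT => /negP Hi; apply: H; exists i.
by rewrite (bigD1 i)//= (negPf ci) mul0r.
Qed.

(** A half-space {y_i > b} is the union of the orthants whose other corner coordinates are -n, and
    open rays generate the Borel sets of the line. *)
Lemma measurable_orthants (A : set Rd) : measurable A -> <<s range orthant >> A.
Proof.
pose S := <<s range orthant >>.
have sS : sigma_algebra setT S by exact: smallest_sigma_algebra.
have [S0 SC SU] := sS.
have SI (F : nat -> set Rd) : (forall n, S (F n)) -> S (\bigcup_n F n) by exact: SU.
have ray i (b : R) : S [set y : Rd | b < y ord0 i].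
  pose c n : Rd := \row_j (if j == i then b else - n%:R).
  have -> : [set y : Rd | b < y ord0 i] = \bigcup_n orthant (c n).
    apply/seteqP; split => [y /= bi|y [n _ /(_ i)]]; last by rewrite mxE eqxx.
    exists (Num.truncn (norm1 y)).+1 => // j; rewrite mxE.
    case: eqP => [->//|_]; rewrite ltrNl (le_lt_trans _ (truncnS_gt _))//.
    by rewrite (le_trans _ (coord_norm1 y j))// -normrN ler_norm.
  by apply: SI => n; apply: sub_sigma_algebra; exists (c n).
have coordS i (B : set R) : measurable (B : set (measurableTypeR R)) ->
    S [set y : Rd | B (y ord0 i)].
  have -> : (@measurable _ (measurableTypeR R)) = (@RGenOInfty.G R).-sigma.-measurable.
    exact: RGenOInfty.measurableE.
  suff sub : <<s @RGenOInfty.G R >> `<=` [set B : set R | S [set y : Rd | B (y ord0 i)]].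
    by move=> mB; exact: (sub B mB).
  apply: smallest_sub.
    clear B; split => [|B SB|F SF] /=.
    - by rewrite (_ : [set _ | _] = set0).
    - rewrite (_ : [set _ | _] = setT `\` [set y : Rd | B (y ord0 i)]); first exact: SC.
      by apply/seteqP; split => y //= [].
    - by rewrite (_ : [set _ | _] = \bigcup_n [set y : Rd | F n (y ord0 i)]); first exact: SU.
  move=> _ [b ->] /=; rewrite (_ : [set _ | _] = [set y : Rd | b < y ord0 i])//.
  by apply/seteqP; split => y /=; rewrite in_itv/= andbT.
apply: smallest_sub => // B; rewrite -bigcup_seq => -[i _] [D mD <-].
by rewrite setTI; exact: coordS.
Qed.

(** Sets over which [f] has integral 0 form a lambda-system, the total integral accounting for the
    whole space, and orthants are stable under intersection: the new corner is the coordinatewise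
    maximum. *)
Lemma ae0_orthants (f : Rd -> R) : mu.-integrable setT (EFin \o f) ->
  \int[mu]_x f x = 0 -> (forall c, \int[mu]_x (f x * \1_(orthant c) x) = 0) ->
  {ae mu, forall x, f x = 0}.
Proof.
move=> intf f0 fc.
have mf : measurable_fun setT f by apply/measurable_EFinP; exact: measurable_int intf.
have b1 (A : set Rd) x : `|\1_A x : R| <= 1.
  by rewrite indicE; case: (_ \in _); rewrite ?normr1 ?normr0.
have int1 (A : set Rd) : measurable A -> mu.-integrable setT (EFin \o (fun x => f x * \1_A x)).
  move=> mA; apply: (le_integrable _ _ _ intf) => //.
    by apply/measurable_EFinP; apply: measurable_funM => //; exact: measurable_indic.
  by move=> x _ /=; rewrite lee_fin normrM ler_piMr.
pose H := [set A : set Rd | measurable A /\ \int[mu]_x (f x * \1_A x) = 0].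
have mO c : measurable (orthant c).
  rewrite (_ : orthant c = \bigcap_(i in [set: 'I_d])
    ((fun x : Rd => x ord0 i : measurableTypeR R) @^-1` `]c ord0 i, +oo[%classic)).
    apply: fin_bigcap_measurable => // i _.
    rewrite -[X in measurable X]setTI; apply: measurable_coord => //; exact: measurable_itv.
  apply/seteqP; split => [y yc i _|y yc i].
    by rewrite /= in_itv/= andbT.
  by have := yc i I; rewrite /= in_itv/= andbT.
have lH : lambda_system setT H.
  split => //.
  - split => //; rewrite -[RHS]f0; congr Rintegral; apply/funext => x.
    by rewrite indicE in_setT mulr1.
  - move=> A B BA [mA A0] [mB B0]; split; first exact: measurableD.
    transitivity (\int[mu]_x (f x * \1_A x - f x * \1_B x)).
      congr Rintegral; apply/funext => x.
      rewrite -mulrBr; congr (_ * _); rewrite !indicE in_setD.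
      have [xB|xB] := boolP (x \in B); last by rewrite andbT subr0.
      by rewrite (_ : x \in A) ?subrr//; move: xB; rewrite !inE; exact: BA.
    by rewrite RintegralB ?A0 ?B0 ?subrr//; exact: int1.
  - move=> F ndF HF; have mF n : measurable (F n) by have [] := HF n.
    split; first exact: bigcup_measurable.
    have := @cvg_Rintegral_bounded R _ _ mu f (fun n => \1_(F n)) (\1_(\bigcup_n F n)) 1 intf
      (fun n => measurable_indic (mF n)) (fun n => b1 (F n)).
    have E n : \int[mu]_x (f x * \1_(F n) x) = 0 by have [] := HF n.
    under eq_cvg do rewrite E.
    suff pw x : (\1_(F n) x : R) @[n --> \oo] --> (\1_(\bigcup_n F n) x : R).
      by move=> /(_ pw) /(cvg_lim (@Rhausdorff R)) <-; rewrite lim_cst.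
    rewrite [X in _ --> X]indicE; have [|xF] := boolP (x \in _).
      rewrite inE => -[n _ Fn]; apply: cvg_near_cst.
      exists n => // m /= nm; rewrite indicE mem_set//.
      by have /subsetPset := ndF _ _ nm; exact.
    apply: cvg_near_cst; apply: nearW => n; rewrite indicE memNset//.
    by move=> Fn; move: xF; rewrite notin_setE; apply; exists n.
have sub : <<s range orthant >> `<=` H.
  apply: (@lambda_system_subset _ (range orthant) _ setT H) => //.
    move=> _ _ [c _ <-] [c' _ <-].
    exists (\row_i Num.max (c ord0 i) (c' ord0 i)) => //.
    apply/seteqP; split => [y yc|y [yc yc'] i].
      by split => i; have := yc i; rewrite mxE gt_max => /andP[].
    by rewrite mxE gt_max yc yc'.
  by move=> _ [c _ <-].
have HA A : measurable A -> \int[mu]_x (f x * \1_A x) = 0.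
  by move=> /measurable_orthants /sub[].
have : ae_eq mu setT (EFin \o f) (cst 0%E).
  apply: integral_ae_eq => // E _ mE; rewrite integral0 integral_mkcond.
  rewrite (_ : (_ \_ _) = (EFin \o (fun x => f x * \1_E x))).
    rewrite -[LHS]fineK; last by apply: integrable_fin_num => //; exact: int1.
    by congr EFin; exact: HA.
  apply/funext => x; rewrite patchE /= indicE.
  by case: (x \in E); rewrite ?mulr1 ?mulr0.
by apply: filterS => x /= /(_ I) [].
Qed.

End orthants.

(** * Vanishing moments *)

Section steps.
Context (R : realType).

Lemma bernoulli_ge (x : R) n : -1 <= x -> 1 + n%:R * x <= (1 + x) ^+ n.
Proof.
move=> x1; elim: n => [|n IH]; first by rewrite mul0r addr0 expr0.
rewrite exprS; apply: (@le_trans _ _ ((1 + x) * (1 + n%:R * x))).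
  rewrite -natr1; have : 0 <= n%:R * x ^+ 2 by rewrite mulr_ge0// sqr_ge0.
  by rewrite expr2; nra.
by rewrite ler_wpM2l//; lra.
Qed.

(** Write r = s^2: Bernoulli's inequality for 1/s = 1 + a bounds n s^n by 1/a, and the other s^n
    tends to 0. *)
Lemma cvg_natr_expr (r : R) : 0 <= r < 1 -> n%:R * r ^+ n @[n --> \oo] --> 0.
Proof.
move=> /andP[r0 r1]; have [->|rn0] := eqVneq r 0.
  apply: cvg_near_cst; exists 1%N => // n /= n1.
  by rewrite expr0n gtn_eqF// mulr0.
have {}r0 : 0 < r by rewrite lt0r rn0.
pose s := Num.sqrt r; have s0 : 0 < s by rewrite sqrtr_gt0.
have s1 : s < 1 by rewrite -sqrtr1 ltr_sqrt.
pose a := s^-1 - 1; have a0 : 0 < a by rewrite subr_gt0 invf_gt1.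
have key n : n%:R * r ^+ n <= a^-1 * s ^+ n.
  have -> : r = s * s by rewrite -expr2 sqr_sqrtr// ltW.
  rewrite exprMn mulrA ler_wpM2r ?exprn_ge0 ?(ltW s0)//.
  rewrite -(ler_pM2l a0) divff ?lt0r_neq0// mulrA.
  have sa : 1 + a = s^-1 by rewrite /a addrC subrK.
  have B : 1 + n%:R * a <= s^-1 ^+ n by rewrite -sa bernoulli_ge//; lra.
  have : (1 + n%:R * a) * s ^+ n <= s^-1 ^+ n * s ^+ n.
    by rewrite ler_wpM2r// exprn_ge0// ltW.
  rewrite -exprMn mulVf ?lt0r_neq0// expr1n mulrDl mul1r [n%:R * a]mulrC.
  by have := exprn_ge0 n (ltW s0); lra.
apply: (@squeeze_cvgr _ _ _ _ (cst 0) (fun n => a^-1 * s ^+ n)).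
- by apply: nearW => n; rewrite key mulr_ge0// exprn_ge0// ltW.
- exact: cvg_cst.
- by rewrite -(mulr0 a^-1); apply: cvgM; [exact: cvg_cst|apply: cvg_expr; rewrite gtr0_norm].
Qed.

(* Tends to the indicator of v > 0 on [-1, 1]; the factor n in the exponent makes
   the limit 0 at v = 0. *)
Definition step n (v : R) : R := (1 - ((1 - v) / 2) ^+ n) ^+ (n * 2 ^ n).

Lemma step_bound n v : -1 <= v <= 1 -> 0 <= step n v <= 1.
Proof.
move=> /andP[v0 v1]; rewrite /step; have u0 : 0 <= (1 - v) / 2 by lra.
have u1 : (1 - v) / 2 <= 1 by lra.
have un : ((1 - v) / 2) ^+ n <= 1 by rewrite exprn_ile1.
have un0 : 0 <= ((1 - v) / 2) ^+ n by rewrite exprn_ge0.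
by rewrite exprn_ge0 ?exprn_ile1//; lra.
Qed.

(** Let u = (1 - v) / 2. If v > 0, Bernoulli's inequality gives at least 1 - n (2u)^n with 2u < 1.
    If v <= 0, then u >= 1/2, and with h = 2^-n, N = n 2^n the value is at most (1 - h)^N <= 1 / (1
    + h)^N <= 1 / (1 + n). *)
Lemma cvg_step v : -1 <= v <= 1 -> step n v @[n --> \oo] --> ((0 < v)%R%:R : R).
Proof.
move=> v11; have vb := step_bound _ v11; move/andP: v11 => [v0 v1].
pose u := (1 - v) / 2; have u0 : 0 <= u by rewrite /u; lra.
have u1 : u <= 1 by rewrite /u; lra.
have stepE n : step n v = (1 - u ^+ n) ^+ (n * 2 ^ n) by [].
have vu : v = 1 - 2 * u by rewrite /u; lra.
clearbody u; have [vp|vn] := ltP 0 v.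
  apply: (@squeeze_cvgr _ _ _ _ (fun n => 1 - n%:R * (2 * u) ^+ n) (cst 1)).
  - apply: nearW => n; have /andP[_ ->] := vb n; rewrite andbT stepE.
    have un1 : u ^+ n <= 1 by rewrite exprn_ile1.
    have := @bernoulli_ge (- u ^+ n) (n * 2 ^ n); rewrite lerN2 => /(_ un1).
    by rewrite exprMn natrM natrX mulrN mulrA.
  - have -> : (true%:R : R) = 1 - 0 by rewrite subr0.
    apply: cvgB; first exact: cvg_cst.
    by apply: cvg_natr_expr; apply/andP; split; lra.
  - exact: cvg_cst.
apply: (@squeeze_cvgr _ _ _ _ (cst 0) (fun n => n.+1%:R^-1)).
- apply: nearW => n; have /andP[-> _] := vb n; rewrite stepE /=.
  have h0 : 0 <= 2^-1 ^+ n :> R by rewrite exprn_ge0// invr_ge0.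
  have h1 : 2^-1 ^+ n <= 1 :> R by rewrite exprn_ile1 ?invr_ge0// invf_le1// ler1n.
  have uh : 2^-1 ^+ n <= u ^+ n.
    by apply: lerXn2r; rewrite ?nnegrE ?invr_ge0//; lra.
  have un1 : u ^+ n <= 1 by rewrite exprn_ile1.
  apply: (@le_trans _ _ ((1 - 2^-1 ^+ n) ^+ (n * 2 ^ n))).
    by apply: lerXn2r; rewrite ?nnegrE ?subr_ge0// lerD2l lerN2.
  have := @bernoulli_ge (2^-1 ^+ n) (n * 2 ^ n) ltac:(lra).
  have -> : (n * 2 ^ n)%:R * 2^-1 ^+ n = n%:R :> R.
    by rewrite natrM natrX -mulrA -exprMn mulfV ?pnatr_eq0// expr1n mulr1.
  rewrite nat1r => B.
  have P0 : 0 <= (1 - 2^-1 ^+ n) ^+ (n * 2 ^ n) :> R by rewrite exprn_ge0// subr_ge0.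
  rewrite -[leRHS]mul1r ler_pdivlMr ?ltr0n//.
  apply: (le_trans (ler_wpM2l P0 B)); rewrite -exprMn.
  rewrite exprn_ile1//; first by rewrite mulr_ge0 ?subr_ge0// addr_ge0.
  rewrite -subr_sqr expr1n; have := exprn_ge0 2 h0; lra.
- exact: cvg_cst.
- exact: cvg_harmonic.
Qed.

(** Once its argument lies between -pi and pi, the sine has the sign of the argument; the sequence
    is then constant. *)
Lemma cvg_sign_sin (t0 x : R) : 0 < t0 ->
  (((0 < sin (t0 / n.+1%:R * x))%R)%:R : R) @[n --> \oo] --> (((0 < x)%R)%:R : R).
Proof.
move=> t00; apply: cvg_near_cst.
have : t0 * `|x| * n.+1%:R^-1 @[n --> \oo] --> 0.
  by rewrite -(mulr0 (t0 * `|x|)); apply: cvgM; [exact: cvg_cst|exact: cvg_harmonic].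
move=> /cvgrPdist_lt /(_ _ (pi_gt0 R)); apply: filterS => n.
rewrite sub0r normrN => H; congr (_%:R).
have tn : 0 < t0 / n.+1%:R by rewrite divr_gt0.
have {}H : `|t0 / n.+1%:R * x| < pi.
  move: H; rewrite [in X in X < _]ger0_norm ?mulr_ge0 ?invr_ge0// ?(ltW t00)//.
  by rewrite normrM (gtr0_norm tn) mulrAC.
have [x0|x0] := ltP 0 x.
  rewrite sin_gt0_pi// mulr_gt0//=.
  by move: H; rewrite gtr0_norm// mulr_gt0.
suff -> : (0 < sin (t0 / n.+1%:R * x)) = false by [].
apply/negbTE; rewrite -leNgt -oppr_ge0 -sinN -mulrN.
apply: sin_ge0_pi; rewrite mulr_ge0 ?oppr_ge0 ?(ltW tn)//=.
by move: H; rewrite ltr_norml => /andP[/ltW H _]; rewrite mulrN lerNl.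
Qed.

End steps.

(** * From vanishing moments to a vanishing function *)

Section moments.
Context (R : realType) (d : nat).
Local Notation Rd := 'rV[R]_d.
Implicit Types (u v phi theta : Rd -> R) (x y z : Rd) (i j : 'I_d) (w : seq 'I_d)
  (T : (Rd -> R) -> R).
Local Notation mu := (lebesgue_rV R d).

Lemma measurable_fun_coord_comp (g : R -> R) i :
  continuous g -> measurable_fun setT (fun y : Rd => g (y ord0 i)).
Proof.
move=> cg; apply: (@measurableT_comp _ _ _ _ _ _ (g : measurableTypeR R -> R)
  _ (fun y : Rd => y ord0 i : measurableTypeR R)).
  exact: continuous_measurable_fun.
exact: measurable_coord.
Qed.

Lemma measurable_cutoff (t : R) : measurable_fun setT (cutoff t : Rd -> R).
Proof.
rewrite (_ : cutoff t = (fun y : Rd => \prod_i (expR 2 *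
    (flat 1 (1 + 1 * (t * y ord0 i)) * flat 1 (1 + (-1) * (t * y ord0 i)))))); last first.
  apply/funext => y; rewrite /cutoff /bumpf fct_prodE; apply: eq_bigr => i _.
  by rewrite /bump_factor !mxE add0r.
apply: measurable_prod => i _.
apply: (measurable_fun_coord_comp (g := fun s => expR 2 *
  (flat 1 (1 + 1 * (t * s)) * flat 1 (1 + (-1) * (t * s))))).
have cf (c : R) : continuous (fun s : R => flat 1 (1 + c * (t * s))).
  move=> s; apply: (@continuous_comp _ _ _ (fun s : R => 1 + c * (t * s)) (flat 1)).
    apply: cvgD; first exact: cvg_cst.
    by apply: cvgM; [exact: cvg_cst|apply: cvgM; [exact: cvg_cst|exact: cvg_id]].
  exact: continuous_flat.
move=> s; apply: cvgM; first exact: cvg_cst.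
by apply: cvgM; [exact: (cf 1)|exact: (cf (-1))].
Qed.

Definition represents (f : Rd -> R) T : Prop :=
  [/\ mu.-integrable setT (EFin \o f), tame_dual T &
      forall phi, test_function phi -> T phi = \int[mu]_x (f x * phi x)].

Lemma represents_cutoff f T u : represents f T -> tame u ->
  \int[mu]_x (f x * (cutoff (n.+1%:R^-1) x * u x)) @[n --> \oo] --> T u.
Proof.
move=> [_ tT Tf] tu.
rewrite (_ : (fun n => \int[mu]_x _) = (fun n => T (cutoff n.+1%:R^-1 * u))).
  exact: cutoff_cvg.
apply/funext => n; rewrite Tf//; apply: test_function_cutoff; last exact: tame_smooth.
by rewrite invr_gt0.
Qed.

Lemma represents_null f T u : represents f T -> tame u ->
  {ae mu, forall x, f x = 0} -> T u = 0.
Proof.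
move=> fT tu f0; have := represents_cutoff fT tu; have [intf _ _] := fT.
have mf : measurable_fun setT f by apply/measurable_EFinP; exact: measurable_int intf.
under eq_cvg do rewrite Rintegral_ae0//.
by move=> /(cvg_lim (@Rhausdorff R)) <-; rewrite lim_cst.
Qed.

(** Both sides are limits of the same integrals against cutoffs: the left by continuity of [T], the
    right by dominated convergence. *)
Lemma represents_bounded f T u (M : R) : represents f T -> tame u ->
  measurable_fun setT u -> (forall x, `|u x| <= M) -> T u = \int[mu]_x (f x * u x).
Proof.
move=> fT tu mu_ uM; have [intf _ _] := fT.
have [_ bM] := bder_bumpf R d; have [L L0 LP] := bM 0%N.
have := @cvg_Rintegral_bounded R _ _ mu f (fun n x => cutoff (n.+1%:R^-1) x * u x) u (L * M) intf.
move=> /(_ (fun n => measurable_funM (measurable_cutoff _) mu_)).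
have c1 n x : `|cutoff n.+1%:R^-1 x * u x| <= L * M.
  by rewrite normrM ler_pM//; exact: (LP [::]).
move=> /(_ c1) H; apply: (cvg_unique _ (represents_cutoff fT tu)) (H _) => //= x.
have [A A0 AP] := bd_cutoff R d 0.
rewrite -[X in _ --> X]mul1r; apply: cvgM; last exact: cvg_cst.
apply/cvgrPdist_le => e e0.
have : A * (1 + norm1 x) * n.+1%:R^-1 @[n --> \oo] --> 0.
  by rewrite -(mulr0 (A * (1 + norm1 x))); apply: cvgM; [exact: cvg_cst|exact: cvg_harmonic].
move=> /cvgrPdist_le /(_ _ e0); apply: filterS => n.
rewrite sub0r normrN => He; rewrite distrC.
have n1 : `|n.+1%:R^-1 : R| <= 1 by rewrite ger0_norm ?invr_ge0// invf_le1 ?ler1n.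
have := AP _ n1 [::] (leqnn _) x => /le_trans; apply; apply: le_trans He.
by rewrite ger0_norm ?invr_ge0// (le_trans _ (ler_norm _))// -mulrA mulrC.
Qed.

(** Products of [f] with bounded measurable [u] are integrable, so this property passes to g - c f
    by linearity of the integral. *)
Definition weakly_represents (f : Rd -> R) T : Prop :=
  [/\ mu.-integrable setT (EFin \o f), tame_dual T &
      forall u (M : R), tame u -> measurable_fun setT u -> (forall x, `|u x| <= M) ->
        T u = \int[mu]_x (f x * u x)].

Lemma weakly_represents_sub (c : R) f g T T' : represents f T -> represents g T' ->
  weakly_represents (fun x => g x - c * f x) (fun u => T' u - c * T u).
Proof.
move=> fT gT; have [intf tT _] := fT; have [intg tT' _] := gT.
have intcf : mu.-integrable setT (EFin \o (fun x => c * f x)).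
  rewrite (_ : EFin \o _ = (fun x => c%:E * (EFin \o f) x)%E)//.
  exact: integrableZl.
split; [|exact: tame_dual_sub|].
  rewrite (_ : EFin \o _ = ((EFin \o g) \- (EFin \o (fun x => (c * f x)%R)))%E)//.
  exact: integrableB.
move=> u M tu mu_ uM.
rewrite (represents_bounded gT tu mu_ uM) (represents_bounded fT tu mu_ uM).
have ub : [bounded u x | x in [set: Rd]].
  exists M; split; first exact: num_real.
  by move=> N MN x _ /=; rewrite (le_trans (uM x))// ltW.
have intfu : mu.-integrable setT (EFin \o (fun x => f x * u x)).
  exact: (integrableMl _ intf mu_ ub).
have intgu : mu.-integrable setT (EFin \o (fun x => g x * u x)).
  exact: (integrableMl _ intg mu_ ub).
rewrite -RintegralZl// -RintegralB//; last first.
  rewrite (_ : EFin \o _ = (fun x => c%:E * (EFin \o (fun x => (f x * u x)%R)) x)%E)//.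
  exact: integrableZl.
by congr Rintegral; apply/funext => x; ring.
Qed.

Lemma cvg_prod_fin (I : finType) (F : nat -> I -> R) (l : I -> R) :
  (forall k, F n k @[n --> \oo] --> l k) ->
  \prod_k F n k @[n --> \oo] --> \prod_k l k.
Proof.
move=> Fl; elim: (index_enum I) => [|k r IH].
  by rewrite big_nil; under eq_cvg do rewrite big_nil; exact: cvg_cst.
rewrite big_cons; under eq_cvg do rewrite big_cons.
by apply: cvgM; [exact: Fl|exact: IH].
Qed.

Section vanishing_moments.
Context (T : (Rd -> R) -> R) (tT : tame_dual T).

(** All moments of the product of [phi] and [T] vanish; the constant 1 qualifies when those of [T]
    do. *)
Definition moment_free phi : Prop :=
  tame phi /\ forall w, T (mono w * phi) = 0.

(** Multipliers compose, hence form an algebra, which reduces polynomials in sines to single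
    sines. *)
Definition multiplier theta : Prop :=
  tame theta /\ forall phi, moment_free phi -> moment_free (phi * theta).

Lemma multiplier_cst (k : R) : multiplier (cst k).
Proof.
split=> [|phi [tphi phi0]]; first exact: tame_cst.
have -> : phi * cst k = k *: phi by apply/funext => x; exact: mulrC.
split=> [|w]; first exact: tameZ.
have -> : mono w * (k *: phi) = k *: (mono w * phi) by apply/funext => x; exact: mulrCA.
by rewrite tame_dualZ ?phi0 ?mulr0//; apply: tameM => //; exact: tame_mono.
Qed.

Lemma multiplierD theta theta' :
  multiplier theta -> multiplier theta' -> multiplier (theta + theta').
Proof.
move=> [tth th] [tth' th']; split=> [|phi Vphi]; first exact: tameD.
have [t1 z1] := th _ Vphi; have [t2 z2] := th' _ Vphi.
rewrite mulrDr; split=> [|w]; first exact: tameD.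
rewrite mulrDr tame_dualD ?z1 ?z2 ?addr0//; apply: tameM => //; exact: tame_mono.
Qed.

Lemma multiplierM theta theta' :
  multiplier theta -> multiplier theta' -> multiplier (theta * theta').
Proof.
move=> [tth th] [tth' th']; split=> [|phi Vphi]; first exact: tameM.
by rewrite mulrA; apply/th'/th.
Qed.

Lemma multiplierX theta n : multiplier theta -> multiplier (fun x => theta x ^+ n).
Proof.
move=> mth; elim: n => [|n IH]; first exact: (multiplier_cst 1).
rewrite (_ : (fun _ => _) = theta * (fun x => theta x ^+ n)); first exact: multiplierM.
by apply/funext => x; rewrite exprS.
Qed.

Lemma multiplierZ (k : R) theta : multiplier theta -> multiplier (k *: theta).
Proof. by move=> mth; apply: (@multiplierM (cst k)) => //; exact: multiplier_cst. Qed.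

Lemma multiplier_sum (I : Type) (r : seq I) (F : I -> Rd -> R) :
  (forall k, multiplier (F k)) -> multiplier (\sum_(k <- r) F k).
Proof.
move=> mF; elim/big_ind : _ => //; [exact: (multiplier_cst 0)|exact: multiplierD].
Qed.

Lemma multiplier_prod (I : Type) (r : seq I) (F : I -> Rd -> R) :
  (forall k, multiplier (F k)) -> multiplier (\prod_(k <- r) F k).
Proof.
move=> mF; elim/big_ind : _ => //; [exact: (multiplier_cst 1)|exact: multiplierM].
Qed.

Lemma multiplier_coord i : multiplier (coordf i).
Proof.
split=> [|phi [tphi phi0]]; first exact: tame_coord.
split=> [|w]; first by apply: tameM => //; exact: tame_coord.
by rewrite mulrA mulrC mulrA -mono_cons phi0.
Qed.

Lemma multiplier_tform k u z : multiplier (tform k u z).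
Proof.
elim: k u => [|k IH] u /=; first exact: multiplier_cst.
by apply: multiplier_sum => i; apply: multiplierM; [exact: multiplier_coord|exact: IH].
Qed.

(* A function whose derivatives are all bounded by 1 is, at low frequency, the sum
   of its Taylor series in the topology where T is continuous. *)
Lemma multiplier_entire : exists2 t0 : R, 0 < t0 & forall t theta, 0 < t <= t0 ->
  csmooth theta -> (forall w x, `|Dw w theta x| <= 1) ->
  multiplier (fun y => theta (0 + t *: y)).
Proof.
have [_ [K [e [C [e0 e1 C0 TC]]]]] := tT.
have e2 : 0 < e / 2 by rewrite divr_gt0.
(* Then 2t <= e / 2: the remainder takes one half of the exponent and [W] the other. *)
exists (e / 4) => [|t theta /andP[t0 te] sth thM]; first by rewrite divr_gt0.
have t1 : `|t| <= 1 by rewrite gtr0_norm//; lra.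
have tth : tame theta.
  by apply: bder_tame; apply: bder_words => // w; exists 1.
have ttht := tame_affine 0 t tth.
split=> // phi [tphi phi0]; split=> [|w]; first exact: tameM.
pose W := mono w * phi; have tW : tame W by apply: tameM => //; exact: tame_mono.
rewrite mulrA -/W.
have [M M0 MP] := tame_bd K tW e2.
have key n : (K <= n)%N ->
    `|T (W * (fun y => theta (0 + t *: y)))| <= C * (2 ^+ K * M) * 2^-1 ^+ (n - K).
  move=> Kn; rewrite (taylor_expansion n) mulrDr tame_dualD//; last 2 first.
  - by apply: tameM => //; apply: tame_sum => k; apply/tameZ/tame_tform.
  - by apply: tameM => //; exact: tame_dtrem.
  rewrite mulr_sumr tame_dual_sum//; last first.
    by move=> k; apply: tameM => //; apply/tameZ/tame_tform.
  (* Taylor polynomials are multipliers, so [T] kills their products with [W] and only the remainder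
     is left. *)
  rewrite big1 ?add0r => [|k _]; last first.
    have [_ H] := (multiplierZ (t ^+ k / k`!%:R) (multiplier_tform k theta 0)).2 _ (conj tphi phi0).
    by rewrite /W -mulrA; exact: H.
  rewrite -mulrA; apply: TC.
  - by apply: tameM => //; exact: tame_dtrem.
  - by rewrite !mulr_ge0 ?exprn_ge0 ?invr_ge0.
  have sd : csmooth (dtrem n theta 0 t) by exact/tame_smooth/tame_dtrem.
  apply: bd_le (bdM (tame_smooth tW) sd MP (bd_dtrem_entire sth t1 Kn thM)) _ => y.
  rewrite -[leLHS]/(2 ^+ K * ((M * expR (e / 2 * norm1 y)) *
    (2^-1 ^+ (n - K) * expR (2 * `|t| * norm1 y)))).
  rewrite [leLHS](_ : _ = 2 ^+ K * M * 2^-1 ^+ (n - K) *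
    (expR (e / 2 * norm1 y) * expR (2 * `|t| * norm1 y))); last ring.
  rewrite -expRD ler_wpM2l//; first by rewrite !mulr_ge0 ?exprn_ge0 ?invr_ge0.
  rewrite ler_expR -mulrDl ler_wpM2r ?norm1_ge0// gtr0_norm//; lra.
set B := C * _ in key.
apply/eqP; rewrite -normr_le0; apply/ler_addgt0Pr => eps eps0; rewrite add0r.
have : B * 2^-1 ^+ n @[n --> \oo] --> 0.
  rewrite -(mulr0 B); apply: cvgM; first exact: cvg_cst.
  by apply: cvg_expr; rewrite gtr0_norm ?invr_gt0// invf_lt1// ltr1n.
move=> /cvgrPdist_le /(_ _ eps0) [n _ nP].
have := nP n (leqnn n); rewrite sub0r normrN => /(le_trans (ler_norm _)).
by apply: le_trans; have := key (n + K)%N (leq_addl _ _); rewrite addnK.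
Qed.

End vanishing_moments.

Definition trig (a b : R) i : Rd -> R := fun y => a * cos (y ord0 i) + b * sin (y ord0 i).

Lemma is_derive_trig (a b : R) i j x :
  is_derive x (delta_mx ord0 j) (trig a b i)
    (trig ((i == j)%:R * b) (- ((i == j)%:R * a)) i x).
Proof.
pose g (s : R) : R := a * cos s + b * sin s.
have gE (s : R) : is_derive s 1 g (a * (- sin s) + b * cos s).
  by apply: is_deriveD; apply: is_deriveZ.
have gE' : is_derive (0 + 1 * x ord0 i) 1 g
    (a * (- sin (0 + 1 * x ord0 i)) + b * cos (0 + 1 * x ord0 i)) by exact: gE.
have := is_derive_coord_comp j gE'; rewrite add0r mul1r.
have -> : (fun y : Rd => g (0 + 1 * y ord0 i)) = trig a b i.
  by apply/funext => y; rewrite add0r mul1r.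
by congr is_derive; rewrite /trig ?add0r !mul1r; ring.
Qed.

(** Derivation along [i] sends the coefficients (a, b) to (b, -a), along other coordinates to 0; the
    bound 1/2 on each persists and gives 1 for the sum. *)
Lemma trig_entire (a b : R) i : `|a| <= 2^-1 -> `|b| <= 2^-1 ->
  csmooth (trig a b i) /\ forall w x, `|Dw w (trig a b i) x| <= 1.
Proof.
pose C := [set u : Rd -> R | exists a b : R, [/\ `|a| <= 2^-1, `|b| <= 2^-1 & u = trig a b i]].
have Cp a' b' j : partial j (trig a' b' i) = trig ((i == j)%:R * b') (- ((i == j)%:R * a')) i.
  by apply/funext => x; have [] := is_derive_trig a' b' i j x.
have nle (k : bool) (s : R) : `|s| <= 2^-1 -> `|k%:R * s| <= 2^-1.
  by case: k => /=; rewrite ?mul1r// mul0r normr0 invr_ge0.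
have CC u : C u -> [/\ continuous u, forall i x, derivable u x (delta_mx ord0 i)
                     & forall i, C (partial i u)].
  move=> [a' [b' [ha hb ->]]]; split=> [x|j x|j].
  - have cg : continuous (fun s : R => a' * cos s + b' * sin s).
      move=> s; apply: cvgD; apply: cvgM; try exact: cvg_cst.
        exact: continuous_cos.
      exact: continuous_sin.
    apply: (@continuous_comp _ _ _ (fun y : Rd => y ord0 i)
      (fun s : R => a' * cos s + b' * sin s)); first exact: coord_continuous.
    exact: cg.
  - by have [] := is_derive_trig a' b' i j x.
  - rewrite Cp; exists ((i == j)%:R * b'), (- ((i == j)%:R * a')).
    by split => //; rewrite ?normrN nle.
move=> ha hb; have Cab : C (trig a b i) by exists a, b.
split; first exact: smooth_class Cab.
move=> w x; have [a' [b' [ha' hb' ->]]] : C (Dw w (trig a b i)).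
  by elim: w => [//|j w IH]; rewrite Dw_cons; have [_ _] := CC _ IH.
have hc : `|cos (x ord0 i)| <= 1 by rewrite ler_norml cos_geN1 cos_le1.
have hs : `|sin (x ord0 i)| <= 1 by rewrite ler_norml sin_geN1 sin_le1.
rewrite /trig (le_trans (ler_normD _ _))// !normrM.
have : `|a'| * `|cos (x ord0 i)| <= 2^-1 * 1 by rewrite ler_pM.
have : `|b'| * `|sin (x ord0 i)| <= 2^-1 * 1 by rewrite ler_pM.
lra.
Qed.

(** The phase [c] enters only the coefficients of sin (t y_i) and cos (t y_i), so [t0] is
    independent of it; the factor 2 undoes the normalization by halves. *)
Lemma multiplier_sin T : tame_dual T -> exists2 t0 : R, 0 < t0 & forall t (c : R) i,
  0 < t <= t0 -> multiplier T (fun y : Rd => sin (t * (y ord0 i - c))).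
Proof.
move=> tT; have [t0 t00 H] := multiplier_entire tT; exists t0 => // t c i tt.
have [||sth thM] := @trig_entire (- (sin (t * c) / 2)) (cos (t * c) / 2) i.
- rewrite normrN normrM (ger0_norm (_ : 0 <= 2^-1)) ?invr_ge0// ler_piMl ?invr_ge0//.
  by rewrite ler_norml sin_geN1 sin_le1.
- rewrite normrM (ger0_norm (_ : 0 <= 2^-1)) ?invr_ge0// ler_piMl ?invr_ge0//.
  by rewrite ler_norml cos_geN1 cos_le1.
have := multiplierZ tT 2 (H t _ tt sth thM).
congr multiplier; apply/funext => y.
rewrite -[LHS]/(2 * trig (- (sin (t * c) / 2)) (cos (t * c) / 2) i (0 + t *: y)).
by rewrite /trig !mxE add0r mulrBr sinB; field.
Qed.

(** Two limits in succession: for fixed [t] the steps of the sines tend to the indicators of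
    positive sines, then t = t0 / (n+1) tends to 0. All approximants are bounded by 1, as dominated
    convergence requires. *)
Lemma vanishing_moments_ae0 f T : weakly_represents f T ->
  (forall w, T (mono w) = 0) -> {ae mu, forall x, f x = 0}.
Proof.
move=> [intf tT Tf] T0; have [t0 t00 mt0] := multiplier_sin tT.
have V1 : moment_free T (cst 1).
  split=> [|w]; first exact: tame_cst.
  by rewrite [_ * _](_ : _ = mono w) ?T0//; apply/funext => x; exact: mulr1.
(* A bounded multiplier is applied to the constant 1 and tested on the empty monomial; there [T] is
   the integral against [f]. *)
have mult0 theta (M : R) : multiplier T theta -> measurable_fun setT theta ->
    (forall x, `|theta x| <= M) -> \int[mu]_x (f x * theta x) = 0.
  move=> [tth th] mth thM; rewrite -(Tf _ _ tth mth thM).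
  have [_ /(_ [::])] := th _ V1; rewrite /mono big_nil mul1r => <-.
  by congr T; apply/funext => x; rewrite -[RHS]/(1 * theta x) mul1r.
apply: ae0_orthants => // [|c].
  rewrite -[RHS](mult0 (cst 1) 1 (multiplier_cst tT 1)) => [||x].
  - by congr Rintegral; apply/funext => x; rewrite mulr1.
  - exact: measurable_cst.
  - by rewrite /cst normr1.
pose s (t : R) i (y : Rd) : R := sin (t * (y ord0 i - c ord0 i)).
have s1 t i y : -1 <= s t i y <= 1 by rewrite sin_geN1 sin_le1.
have prod1 (F : 'I_d -> R) : (forall i, 0 <= F i <= 1) -> `|\prod_i F i| <= 1.
  move=> F01; rewrite normr_prod prodr_ile1// => i _.
  by have /andP[F0 F1] := F01 i; rewrite normr_ge0 ger0_norm.
have ms t i : continuous (fun r : R => sin (t * (r - c ord0 i))).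
  move=> r; apply: (@continuous_comp _ _ _ (fun r : R => t * (r - c ord0 i)) sin).
    by apply: cvgM; [exact: cvg_cst|apply: cvgB; [exact: cvg_id|exact: cvg_cst]].
  exact: continuous_sin.
have mst t i : measurable_fun setT (s t i) by exact: (measurable_fun_coord_comp i (ms t i)).
have mstep t n : measurable_fun setT (fun x => \prod_i step n (s t i x)).
  apply: measurable_prod => i _; apply: measurable_funX.
  apply: measurable_funB; first exact: measurable_cst.
  apply: measurable_funX; apply: measurable_funM; last exact: measurable_cst.
  by apply: measurable_funB => //; exact: measurable_cst.
have m1B theta : multiplier T theta -> multiplier T (fun x => 1 - theta x).
  move=> mth; rewrite (_ : (fun _ => _) = cst 1 + (-1) *: theta).
    by apply: multiplierD => //; [exact: multiplier_cst|exact: multiplierZ].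
  by apply/funext => x; rewrite scaleN1r.
(* Measurability of the limit is returned as well, because the first limit is fed into the
   second. *)
have lim0 (phi : nat -> Rd -> R) (psi : Rd -> R) : (forall n, measurable_fun setT (phi n)) ->
    (forall n x, `|phi n x| <= 1) -> (forall n, \int[mu]_x (f x * phi n x) = 0) ->
    (forall x, phi n x @[n --> \oo] --> psi x) ->
    measurable_fun setT psi /\ \int[mu]_x (f x * psi x) = 0.
  move=> mphi phi1 phi0 phipsi; split.
    by apply: (@measurable_fun_cvg _ _ _ _ phi) => // x _; exact: phipsi.
  have := cvg_Rintegral_bounded intf mphi phi1 phipsi.
  under eq_cvg do rewrite phi0.
  by move=> /(cvg_lim (@Rhausdorff R)) <-; rewrite lim_cst.
have E1 t n : 0 < t <= t0 -> \int[mu]_x (f x * \prod_i step n (s t i x)) = 0.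
  move=> tt; have mth : multiplier T (\prod_i (fun x => step n (s t i x))).
    apply: multiplier_prod => // i; apply: (@multiplierX _ tT).
    apply: (m1B _); apply: (@multiplierX _ tT).
    have := multiplierZ tT 2^-1 (m1B _ (mt0 t (c ord0 i) i tt)).
    by congr multiplier; apply/funext => x; exact: mulrC.
  have := mult0 _ 1 mth; rewrite fct_prodE; apply; first exact: mstep.
  by move=> x; apply: prod1 => i; exact: step_bound.
have E2 t : 0 < t <= t0 ->
    measurable_fun setT (fun x => \prod_i ((0 < s t i x)%R%:R : R)) /\
    \int[mu]_x (f x * \prod_i (0 < s t i x)%R%:R) = 0.
  move=> tt; apply: (lim0 (fun n x => \prod_i step n (s t i x))) => [n|n x|n|x].
  - exact: mstep.
  - by apply: prod1 => i; exact: step_bound.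
  - exact: E1.
  - by apply: cvg_prod_fin => i; exact: cvg_step.
have tn n : 0 < t0 / n.+1%:R <= t0.
  by rewrite divr_gt0//= ler_pdivrMr// ler_peMr ?ler1n// ltW.
suff [_ //] : measurable_fun setT (\1_(orthant c) : Rd -> R) /\
    \int[mu]_x (f x * \1_(orthant c) x) = 0.
apply: (lim0 (fun n x => \prod_i (0 < s (t0 / n.+1%:R) i x)%R%:R)) => [n|n x|n|x].
- exact: (E2 _ (tn n)).1.
- by apply: prod1 => i; case: (_ < _); rewrite ?ler01 ?lexx.
- exact: (E2 _ (tn n)).2.
- rewrite orthantE; apply: cvg_prod_fin => i.
  by rewrite -subr_gt0; exact: cvg_sign_sin.
Qed.

End moments.

(** * Determination by the zero sets *)

Section determination.
Context (R : realType) (d : nat).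
Local Notation Rd := 'rV[R]_d.
Implicit Types (f g u : Rd -> R) (x y z : Rd) (i j : 'I_d) (w : seq 'I_d)
  (T : (Rd -> R) -> R).
Local Notation mu := (lebesgue_rV R d).

Lemma conv_transform T u (s : R) x : tame_dual T -> tame u ->
  Defs.conv T (dilate s u) x = s ^- d * transform T u (- s^-1) (s^-1 *: x).
Proof.
move=> tT tu; rewrite /transform -tame_dualZ//; last exact: tame_affine.
congr T; apply/funext => y; rewrite /dilate scalerBr.
by rewrite -[RHS]/(s ^- d * u (s^-1 *: x + - s^-1 *: y)) scaleNr.
Qed.

Lemma PdualL1_represents (gamma : R) f T : 0 < gamma -> PdualL1 gamma f T -> represents f T.
Proof. by move=> g0 [intf dT Tf]; split => //; exact: Pdual_tame_dual dT. Qed.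

Lemma represents_weakly f T : represents f T -> weakly_represents f T.
Proof.
move=> fT; have [intf tT _] := fT; split => // u M.
exact: represents_bounded.
Qed.

Definition first_moment T n : Prop :=
  (forall w, (size w < n)%N -> T (mono w) = 0) /\ exists2 w, size w = n & T (mono w) != 0.

Lemma first_momentP T : (forall w, T (mono w) = 0) \/ exists n, first_moment T n.
Proof.
have [H|H] := pselect (forall w, T (mono w) = 0); [by left|right].
have ex : exists n, `[< exists2 w, size w = n & T (mono w) != 0 >].
  move: H => /existsNP[w /eqP w0]; exists (size w); apply/asboolP.
  by exists w.
case: (ex_minnP ex) => n /asboolP nP nmin; exists n; split=> // w wn.
apply/eqP; apply: contraTT wn => w0; rewrite -leqNgt; apply: nmin.
by apply/asboolP; exists w.
Qed.

Lemma first_moment_nonzero T n : first_moment T n -> nonzero_coeffs n (@moment_coeff R d T n).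
Proof.
move=> [_ [w wn Tw]]; exists (mult w); first by rewrite mdegree_mult.
have [k k0 kE] := moment_coeffE R w.
by rewrite -wn kE mulrn_eq0 negb_or -lt0n k0.
Qed.

Lemma transform_eq0 T u n z : tame_dual T -> tame u ->
  (forall w, (size w < n)%N -> T (mono w) = 0) ->
  (forall k : nat, transform T u (- (2 ^+ k)^-1) z = 0) -> T (tform n u z) = 0.
Proof.
move=> tT tu Tn T0; have [B B0 BP] := transform_asymptotics (norm1 z) tT tu Tn.
have f0 : 0 < n`!%:R :> R by rewrite ltr0n fact_gt0.
apply: contrapT => /eqP A0; set A := T _ in A0 BP.
have q0 : 0 < `|A| / n`!%:R by rewrite divr_gt0// normr_gt0.
have B1 : 0 < B + 1 by rewrite ltr_wpDl.
have [k kq] := pow2_small (divr_gt0 q0 B1).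
pose t : R := - (2 ^+ k)^-1.
have p0 : 0 < (2 ^+ k)^-1 :> R by rewrite invr_gt0 exprn_gt0.
have t0 : t != 0 by rewrite oppr_eq0 lt0r_neq0.
have tE : `|t| = (2 ^+ k)^-1 by rewrite normrN gtr0_norm.
have t1 : `|t| <= 1 by rewrite tE invf_le1 ?exprn_gt0// exprn_ege1// ler1n.
have Bt : B * `|t| < `|A| / n`!%:R.
  apply: (@le_lt_trans _ _ ((B + 1) * `|t|)); first by rewrite ler_wpM2r// lerDl.
  by rewrite tE mulrC -ltr_pdivlMr.
have := BP t z t1 (lexx _); rewrite T0 => H.
(* [approx_pos] with 0 as the value of the transform, used for [A] or [- A] according to the sign,
   gives an absurdity. *)
have : 0 < t ^+ n * 0.
  have [Ap|An] := leP 0 A.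
    by apply: (approx_pos t0 H); rewrite (ger0_norm Ap) in Bt.
  apply: (@approx_pos _ 0 (- A) B t n t0); last by rewrite (ltr0_norm An) in Bt.
  by move: H; rewrite !sub0r mulrN !normrN.
by rewrite mulr0 ltxx.
Qed.

Context (psi : Rd -> R) (tpsi : tame psi) (gpsi : generic psi).

Lemma first_moment_regular_zeros T1 T2 n m : tame_dual T1 -> tame_dual T2 ->
  first_moment T1 n -> first_moment T2 m ->
  (forall (k : nat) z, transform T1 psi (- (2 ^+ k)^-1) z = 0 ->
                       transform T2 psi (- (2 ^+ k)^-1) z = 0) ->
  n = m /\ proportional n (@moment_coeff R d T1 n) (@moment_coeff R d T2 m).
Proof.
move=> tT1 tT2 T1n T2m T12; apply: contrapT => np.
apply: (gpsi (first_moment_nonzero T1n) (first_moment_nonzero T2m) np).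
have := regular_zeros_limit tT1 tT2 tpsi T1n.1 T2m.1 T12.
have E T k : tame_dual T -> (fun z => T (tform k psi z)) = hdiff k (@moment_coeff R d T k) psi.
  by move=> tT; apply/funext => z; apply: hdiff_moment => //; exact: tame_smooth.
by rewrite !E.
Qed.

(** If the transform vanished, so would the leading derivative of [psi], and its zero set would
    contain the regular zeros of any derivative of order n + 1. *)
Lemma nonzero_transform (T : (Rd -> R) -> R) n : (0 < d)%N -> tame_dual T -> first_moment T n ->
  ~ (forall (k : nat) z, transform T psi (- (2 ^+ k)^-1) z = 0).
Proof.
move=> d0 tT Tn T0.
have nz : nonzero_coeffs n.+1 (cst 1 : multiindex d -> R).
  exists (mult (nseq n.+1 (Ordinal d0))); last exact: oner_neq0.
  by rewrite mdegree_mult size_nseq.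
apply: (gpsi nz (first_moment_nonzero Tn)) => [[]|z _].
  by move=> /eqP; rewrite gtn_eqF.
rewrite /zeros/= -hdiff_moment//; last exact: tame_smooth.
by apply: transform_eq0 => //; exact: Tn.1.
Qed.

Lemma determined f g Tf Tg : (0 < d)%N -> represents f Tf -> represents g Tg ->
  (forall (k : nat) z, transform Tf psi (- (2 ^+ k)^-1) z = 0 <->
                       transform Tg psi (- (2 ^+ k)^-1) z = 0) ->
  exists2 c : R, c != 0 & {ae mu, forall x, g x = c * f x}.
Proof.
move=> d0 fT gT fg.
have [_ tTf _] := fT; have [_ tTg _] := gT.
have aff k z : tame (fun y : Rd => psi (z + - (2 ^+ k)^-1 *: y)) by exact: tame_affine.
have [f0|[n fn]] := first_momentP Tf; have [g0|[m gm]] := first_momentP Tg.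
- exists 1; first exact: oner_neq0.
  have := vanishing_moments_ae0 (represents_weakly fT) f0.
  have := vanishing_moments_ae0 (represents_weakly gT) g0.
  by apply: filterS2 => x -> ->; rewrite mulr0.
(* Here [f] is 0 almost everywhere, so its transform is identically 0, and by the equality of zero
   sets that of [g] is too. *)
- case: (nonzero_transform d0 tTg gm) => k z; apply/fg.
  apply: (represents_null fT) => //.
  exact: vanishing_moments_ae0 (represents_weakly fT) f0.
- case: (nonzero_transform d0 tTf fn) => k z; apply/fg.
  apply: (represents_null gT) => //.
  exact: vanishing_moments_ae0 (represents_weakly gT) g0.
have [nm [c c0 cP]] := first_moment_regular_zeros tTf tTg fn gm (fun k z => (fg k z).1).
exists c => //; pose Th u := Tg u - c * Tf u.
have hT := weakly_represents_sub c fT gT; have [_ tTh _] := hT.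
(* Order [n] is included: [c] cancels these moments. *)
have Thn w : (size w <= n)%N -> Th (mono w) = 0.
  rewrite leq_eqVlt => /orP[/eqP wn|wn]; last first.
    by rewrite /Th fn.1// gm.1 -?nm// mulr0 subrr.
  have [k k0 kE] := moment_coeffE R w.
  have := cP (mult w); rewrite mdegree_mult => /(_ wn).
  rewrite -nm -wn !kE mulrnAr => /eqP; rewrite eqr_pMn2r//.
  by move=> /eqP E; rewrite /Th E subrr.
suff : forall w, Th (mono w) = 0.
  move=> /(vanishing_moments_ae0 hT); apply: filterS => x /eqP.
  by rewrite subr_eq0 => /eqP.
(* A nonzero moment of [Th] would first occur at order k = n, where all its moments vanish. *)
have [//|[k hk]] := first_momentP Th.
have [|nk _] := first_moment_regular_zeros tTf tTh fn hk.
  move=> l z Tz; rewrite /transform -/(transform Tg psi _ z) -/(transform Tf psi _ z).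
  by rewrite Tz ((fg l z).1 Tz) mulr0 subrr.
have [_ [w wk]] := hk; by rewrite Thn ?eqxx// wk nk.
Qed.

End determination.

Theorem corollary2 (R : realType) (d : nat) (psi : 'rV[R]_d -> R) (gamma : R) :
  (1 <= d)%N -> Pall psi -> generic psi -> 0 < gamma ->
  determined_by_zeros gamma psi [set sigma | 0 < sigma] /\
  determined_by_zeros gamma psi (range (fun i : nat => 2 ^+ i)).
Proof.
move=> d0 Ppsi gpsi g0; have tpsi := tame_Pall Ppsi.
suff H : determined_by_zeros gamma psi (range (fun i : nat => 2 ^+ i)).
  split=> // f g Tf Tg fT gT fg; apply: H fT gT _ => _ [k _ <-].
  by apply: fg; rewrite /= exprn_gt0.
move=> f g Tf Tg fT gT fg.
have rf := PdualL1_represents g0 fT; have rg := PdualL1_represents g0 gT.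
apply: (determined tpsi gpsi d0 rf rg) => k z.
have [_ tTf _] := rf; have [_ tTg _] := rg.
have p0 : (2 ^+ k : R) != 0 by rewrite expf_neq0.
have E T : tame_dual T -> zeros (Defs.conv T (dilate (2 ^+ k) psi)) (2 ^+ k *: z) <->
    transform T psi (- (2 ^+ k)^-1) z = 0.
  move=> tT; rewrite /zeros/= conv_transform// scalerA mulVf// scale1r.
  split=> [/eqP|->]; last by rewrite mulr0.
  by rewrite mulf_eq0 invr_eq0 expf_eq0 (negPf p0) andbF/= => /eqP.
by rewrite -(E _ tTf) -(E _ tTg) fg//; exists k.
Qed.
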